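(* Let $H,K$ be complex Hilbert spaces, let $\mathcal{A}$ be any closed complex subspace of $\mathcal{L}(H,K)$, let $C\in\mathcal{L}(K,H)$, $D\in\mathcal{L}(H)$, and let $Z_0\in\mathcal{A}$ be such that $(CZ_0+D)^{-1}$ exists. Put $X_0=(CZ_0+D)^{-1}C$ and assume that $ZX_0Z\in\mathcal{A}$ for all $Z\in\mathcal{A}$. Let $\mathcal{D}$ be the connected component containing $Z_0$ of $\{Z\in\mathcal{A}:(CZ+D)^{-1}\text{ exists}\}$ (such a $\mathcal{D}$ is called the domain of a linear fractional transformation on $\mathcal{A}$). Let $\mathcal{X}$ be any complex Banach space. If $h:\mathcal{D}\to\mathcal{X}$ is a bounded holomorphic function, then $h$ is constant. In particular, $\mathcal{D}$ is not holomorphically equivalent to a bounded domain.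
   Context: $\mathcal{L}(H,K)$ is the Banach space of bounded linear operators from $H$ to $K$ with the operator norm, and $\mathcal{L}(H)=\mathcal{L}(H,H)$. ''$(CZ+D)^{-1}$ exists'' means that $CZ+D$ is invertible in $\mathcal{L}(H)$. Holomorphic means complex Fréchet differentiable on an open set. A domain is a non-empty connected open subset of a complex Banach space, and it is bounded if it is a norm-bounded set. Two domains are holomorphically equivalent if there is a holomorphic bijection of one onto the other with holomorphic inverse.
   Formalization: The ''in particular'' clause assumes that 𝒜 or the Banach space containing the bounded domain is nonzero; if both are {0}, then 𝒟={0} is itself a bounded domain and the clause is false. *)

(* Defs.v *)
From HB Require Import structures.
From mathcomp Require Import all_boot all_order all_algebra.
From mathcomp Require Import complex ring.
From mathcomp Require Import all_classical all_reals all_analysis.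

Set Implicit Arguments.
Unset Strict Implicit.
Unset Printing Implicit Defensive.
Import Order.TTheory GRing.Theory Num.Theory.
Import numFieldNormedType.Exports.

Local Open Scope classical_set_scope.
Local Open Scope complex_scope.
Local Open Scope ring_scope.

(* The scalars are `R[i]` for an arbitrary `R : realType`; norms are therefore
   `R[i]`-valued (and real).  A Hilbert space is a complete normed module whose
   norm comes from an inner product, linear in its first argument and
   conjugate-linear in its second. *)
HB.mixin Record CompleteNormedModule_isHilbert (R : realType) H
    & CompleteNormedModule R[i] H := {
  hdot : {dot H for @Num.conj R[i]};
  hdot_norm : forall x : H, `|x| ^+ 2 = hdot x x
}.

#[short(type="hilbertType")]
HB.structure Definition Hilbert (R : realType) :=
  {H of CompleteNormedModule R[i] H & CompleteNormedModule_isHilbert R H}.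

Section BoundedLinear.
Context {R : realType}.
Implicit Types U V W : normedModType R[i].

Definition bounded_linear U V : {pred U -> V} :=
  fun f => `[< linear f /\ exists M : R[i], forall x, `|f x| <= M * `|x| >].

Record bop U V := Bop {
  bop_fun :> U -> V;
  bopP : bop_fun \in @bounded_linear U V }.

Lemma bounded_linear_submod U V : submod_closed (@bounded_linear U V).
Proof.
split.
- apply/asboolP; split; first by move=> a x y; rewrite /= scaler0 addr0.
  by exists 0 => x; rewrite normr0 mul0r.
- move=> a f g /asboolP[lf [M fM]] /asboolP[lg [N gN]]; apply/asboolP; split.
    move=> b x y; have -> z : (a *: f + g) z = a *: f z + g z by [].
    by rewrite lf lg !scalerDr !scalerA (mulrC b) addrACA.
  exists (`|a| * M + N) => x; rewrite mulrDl (le_trans (ler_normD _ _))//.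
  by rewrite lerD// normrZ -mulrA ler_wpM2l.
Qed.

End BoundedLinear.

HB.instance Definition _ (R : realType) (U V : normedModType R[i]) :=
  [isSub for @bop_fun R U V].
HB.instance Definition _ (R : realType) (U V : normedModType R[i]) :=
  [Choice of bop U V by <:].
HB.instance Definition _ (R : realType) (U V : normedModType R[i]) :=
  GRing.isSubmodClosed.Build _ _ (@bounded_linear R U V)
    (@bounded_linear_submod R U V).
HB.instance Definition _ (R : realType) (U V : normedModType R[i]) :=
  [SubChoice_isSubLmodule of bop U V by <:].

Section OperatorNorm.
Context {R : realType} {U V : normedModType R[i]}.
Implicit Types (T S : bop U V) (x y : U).

(* `complex.Re` only brings the real-valued norms from `R[i]` down to `R`,
   where suprema live; the set always has a supremum (opnorm_sup). *)
Definition opnorm T : R[i] :=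
  (sup [set complex.Re `|T x| | x in [set x : U | `|x| <= 1]])%:C.

Lemma bop_linear T : linear T.
Proof. by case: T => f /= /asboolP[]. Qed.

Lemma bop_bounded T : exists M : R[i], forall x, `|T x| <= M * `|x|.
Proof. by case: T => f /= /asboolP[]. Qed.

Lemma bopDE T S x : (T + S) x = T x + S x. Proof. by []. Qed.
Lemma bopZE a T x : (a *: T) x = a *: T x. Proof. by []. Qed.
Lemma bopNE T x : (- T) x = - T x. Proof. by []. Qed.
Lemma bopBE T S x : (T - S) x = T x - S x. Proof. by []. Qed.
Lemma bopZ T a x : T (a *: x) = a *: T x.
Proof.
have T0 : T 0 = 0.
  by have := bop_linear T (-1) 0 0; rewrite scaler0 addr0 scaleN1r addNr.
by have := bop_linear T a x 0; rewrite T0 !addr0.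
Qed.
Lemma bop0 T : T 0 = 0. Proof. by rewrite -(scale0r 0) bopZ scale0r. Qed.
Lemma bopD T x y : T (x + y) = T x + T y.
Proof. by have := bop_linear T 1 x y; rewrite !scale1r. Qed.

Lemma ReK (W : normedModType R[i]) (w : W) : (complex.Re `|w|)%:C = `|w|.
Proof. by rewrite RRe_real// ger0_real. Qed.

Lemma opnorm_sup T :
  has_sup [set complex.Re `|T x| | x in [set x : U | `|x| <= 1]].
Proof.
split; first by exists (complex.Re `|T 0|), 0 => //=; rewrite normr0.
have [M TM] := bop_bounded T.
exists (complex.Re `|M|) => _ [x /= x1 <-].
rewrite -lecR ReK (RRe_real (ger0_real (normr_ge0 M))) (le_trans (TM x))//.
have [->|x0] := eqVneq x 0; first by rewrite normr0 mulr0.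
have M0 : 0 <= M.
  by rewrite -(pmulr_lge0 _ (_ : 0 < `|x|)) ?normr_gt0// (le_trans _ (TM x)).
by rewrite ger0_norm// ler_piMr.
Qed.

Lemma opnorm_ge0 T : 0 <= opnorm T.
Proof.
rewrite /opnorm lecR; apply: (le_trans (_ : 0 <= complex.Re `|T 0|)).
  by rewrite -lecR ReK; exact: normr_ge0.
by apply: ub_le_sup; [exact: (opnorm_sup T).2|exists 0 => //=; rewrite normr0].
Qed.

Lemma le_opnorm T x : `|T x| <= opnorm T * `|x|.
Proof.
have [->|x0] := eqVneq x 0; first by rewrite bop0 !normr0 mulr0.
have nx0 : 0 < `|x| by rewrite normr_gt0.
rewrite -ler_pdivrMr// mulrC.
have -> : `|x|^-1 * `|T x| = `|T (`|x|^-1 *: x)|.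
  by rewrite bopZ normrZ gtr0_norm// invr_gt0.
rewrite -ReK lecR; apply: ub_le_sup; first exact: (opnorm_sup T).2.
exists (`|x|^-1 *: x) => //=.
by rewrite normrZ gtr0_norm ?invr_gt0// mulVf// gt_eqF.
Qed.

Lemma opnorm_le T M : 0 <= M -> (forall x, `|T x| <= M * `|x|) -> opnorm T <= M.
Proof.
move=> M0 TM; have ReM : (complex.Re M)%:C = M by rewrite RRe_real// ger0_real.
rewrite -ReM lecR; apply: ge_sup; first exact: (opnorm_sup T).1.
move=> _ [x /= x1 <-]; rewrite -lecR ReK ReM (le_trans (TM x))//.
by rewrite ler_piMr.
Qed.

Lemma opnormD T S : opnorm (T + S) <= opnorm T + opnorm S.
Proof.
apply: opnorm_le; first by rewrite addr_ge0 ?opnorm_ge0.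
by move=> x; rewrite mulrDl (le_trans (ler_normD _ _))// lerD// le_opnorm.
Qed.

Lemma opnormZ_le a T : opnorm (a *: T) <= `|a| * opnorm T.
Proof.
apply: opnorm_le; first by rewrite mulr_ge0 ?opnorm_ge0.
by move=> x; rewrite bopZE normrZ -mulrA ler_wpM2l// le_opnorm.
Qed.

Lemma opnorm0_eq0 T : opnorm T = 0 -> T = 0.
Proof.
move=> T0; apply: val_inj; apply/funext => x /=; apply/eqP.
by rewrite -normr_le0 (le_trans (le_opnorm T x))// T0 mul0r.
Qed.

Lemma opnormZ a T : opnorm (a *: T) = `|a| * opnorm T.
Proof.
apply/eqP; rewrite eq_le opnormZ_le /=.
have [->|a0] := eqVneq a 0; first by rewrite normr0 mul0r opnorm_ge0.
rewrite mulrC -ler_pdivlMr ?normr_gt0// mulrC -normfV.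
by rewrite -{1}[T](scalerK a0) opnormZ_le.
Qed.

End OperatorNorm.

HB.instance Definition _ (R : realType) (U V : normedModType R[i]) :=
  Lmodule_isNormed.Build R[i] (bop U V) (@opnormD R U V) (@opnormZ R U V)
    (@opnorm0_eq0 R U V).

Section Completeness.
Context {R : realType} {U : normedModType R[i]} {V : completeNormedModType R[i]}.

Lemma bop_complete (F : set_system (bop U V)) :
  ProperFilter F -> cauchy F -> cvg F.
Proof.
move=> FF Fc.
have Fe (e : R[i]) : 0 < e -> exists S : bop U V,
    F [set T : bop U V | forall x, `|T x - S x| <= e * `|x|].
  move=> e0; have /cauchyP/(_ e e0)[S FS] := Fc.
  exists S; apply: filterS FS => T ST x; rewrite -bopBE.
  rewrite (le_trans (le_opnorm _ _))// ler_wpM2r//.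
  by move: ST; rewrite -ball_normE /= distrC => /ltW.
have Fx x : cvg ((fun T => (T : bop U V) x) @ F).
  apply: cauchy_cvg; apply/cauchyP => e e0.
  have d0 : 0 < e / (`|x| + 1) by rewrite divr_gt0// ltr_wpDl.
  have [S FS] := Fe _ d0.
  exists (S x); rewrite -[_ (ball _ _)]/(F [set T : bop U V | ball (S x) e (T x)]).
  apply: filterS FS => T /= TS.
  rewrite -ball_normE /= distrC (le_lt_trans (TS x))//.
  by rewrite mulrAC ltr_pdivrMr ?ltr_wpDl// ltr_pM2l// ltrDl.
pose f x := lim ((fun T => (T : bop U V) x) @ F).
have fx x : (fun T => (T : bop U V) x) @ F --> f x := Fx x.
have Ff (e : R[i]) : 0 < e ->
    F [set T : bop U V | forall x, `|T x - f x| <= e * `|x|].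
  move=> e0; have e30 : 0 < e / 3 by rewrite divr_gt0.
  have [S FS] := Fe _ e30.
  apply: filterS (FS) => T TS x.
  have [->|x0] := eqVneq x 0.
    have -> : f 0 = 0.
      by apply: cvg_lim => //; under eq_fun do rewrite bop0; exact: cvg_cst.
    by rewrite bop0 subrr !normr0 mulr0.
  have d0 : 0 < e / 3 * `|x| by rewrite mulr_gt0// normr_gt0.
  have /cvgr_dist_lt /(_ _ d0) fxd := fx x.
  have [T' [T'S T'f]] := filter_ex (filterI FS fxd).
  have -> : T x - f x = (T x - S x) - (T' x - S x) - (f x - T' x).
    by rewrite !opprB !addrA subrK subrK.
  have -> : e * `|x| = e / 3 * `|x| + e / 3 * `|x| + e / 3 * `|x| by field.
  rewrite (le_trans (ler_normB _ _))// lerD//; last exact: ltW.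
  by rewrite (le_trans (ler_normB _ _))// lerD.
have f_lin : linear f.
  move=> a x y; apply: cvg_lim => //.
  under eq_fun do rewrite bop_linear.
  by apply: cvgD => //; apply: cvgZr.
have f_bnd : exists M : R[i], forall x, `|f x| <= M * `|x|.
  have [T Tf] := filter_ex (Ff 1 ltr01).
  exists (opnorm T + 1) => x; rewrite -[f x](subKr (T x)) mulrDl.
  by rewrite (le_trans (ler_normB _ _))// lerD// le_opnorm.
have fP : f \in @bounded_linear R U V by apply/asboolP.
apply/cvg_ex; exists (Bop fP); apply/cvgrPdist_le => e e0.
apply: filterS (Ff e e0) => T Tf; rewrite distrC.
by apply: opnorm_le; [exact: ltW|move=> x; exact: Tf].
Qed.

End Completeness.

HB.instance Definition _ (R : realType) (U : normedModType R[i])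
  (V : completeNormedModType R[i]) :=
  Uniform_isComplete.Build (bop U V) (@bop_complete R U V).

Section Composition.
Context {R : realType} {U V W : normedModType R[i]}.

Lemma bcomp_subproof (T : bop V W) (S : bop U V) :
  (T \o S) \in @bounded_linear R U W.
Proof.
apply/asboolP; split; first by move=> a x y /=; rewrite !bop_linear.
exists (opnorm T * opnorm S) => x /=; rewrite (le_trans (le_opnorm _ _))//.
by rewrite -mulrA ler_wpM2l ?opnorm_ge0// le_opnorm.
Qed.

Definition bcomp T S : bop U W := Bop (bcomp_subproof T S).

Lemma bid_subproof : idfun \in @bounded_linear R U U.
Proof. by apply/asboolP; split=> //; exists 1 => x; rewrite mul1r. Qed.

Definition bid : bop U U := Bop bid_subproof.

End Composition.

Section Inverse.
Context {R : realType} {U : normedModType R[i]}.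

Definition is_binv (T S : bop U U) := bcomp T S = bid /\ bcomp S T = bid.

Definition binvertible (T : bop U U) := exists S, is_binv T S.

(* Junk value 0 when T is not invertible. *)
Definition binv (T : bop U U) : bop U U := xget 0 [set S | is_binv T S].

Lemma binvP T : binvertible T -> is_binv T (binv T).
Proof. by move=> [S TS]; exact: (xgetPex 0 (ex_intro _ S TS)). Qed.

End Inverse.

Record csubspace (R : realType) (V : normedModType R[i]) := CSubspace {
  csub_set : set V;
  csub_set0 : csub_set 0;
  csub_set_linear : forall (a : R[i]) x y,
    csub_set x -> csub_set y -> csub_set (a *: x + y);
  csub_set_closed : closed csub_set }.

Section ClosedSubspace.
Context {R : realType} {V : normedModType R[i]}.
Implicit Type A : csubspace V.

Definition csub_pred A : {pred V} := fun x => `[< csub_set A x >].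

Record csub A := CSub { csub_val : V; csub_valP : csub_val \in csub_pred A }.

Lemma csub_submod A : submod_closed (csub_pred A).
Proof.
split; first by apply/asboolP; exact: csub_set0.
by move=> a x y /asboolP Ax /asboolP Ay; apply/asboolP; exact: csub_set_linear.
Qed.

Lemma csubP A (x : csub A) : csub_set A (csub_val x).
Proof. by case: x => x /= /asboolP. Qed.

End ClosedSubspace.

Coercion csub : csubspace >-> Sortclass.

HB.instance Definition _ (R : realType) (V : normedModType R[i])
  (A : csubspace V) := [isSub for @csub_val R V A].
HB.instance Definition _ (R : realType) (V : normedModType R[i])
  (A : csubspace V) := [Choice of csub A by <:].
HB.instance Definition _ (R : realType) (V : normedModType R[i])
  (A : csubspace V) :=
  GRing.isSubmodClosed.Build _ _ (@csub_pred R V A) (@csub_submod R V A).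
HB.instance Definition _ (R : realType) (V : normedModType R[i])
  (A : csubspace V) := [SubChoice_isSubLmodule of csub A by <:].

Section SubspaceNorm.
Context {R : realType} {V : normedModType R[i]} {A : csubspace V}.

Definition csub_norm (x : A) : R[i] := `|csub_val x|.

Lemma csub_normD (x y : A) : csub_norm (x + y) <= csub_norm x + csub_norm y.
Proof. exact: ler_normD. Qed.

Lemma csub_normZ (a : R[i]) (x : A) : csub_norm (a *: x) = `|a| * csub_norm x.
Proof. exact: normrZ. Qed.

Lemma csub_norm0_eq0 (x : A) : csub_norm x = 0 -> x = 0.
Proof. by move=> /eqP; rewrite normr_eq0 => /eqP x0; exact: val_inj. Qed.

End SubspaceNorm.

HB.instance Definition _ (R : realType) (V : normedModType R[i])
  (A : csubspace V) :=
  Lmodule_isNormed.Build R[i] (csub A) (@csub_normD R V A) (@csub_normZ R V A)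
    (@csub_norm0_eq0 R V A).

Lemma csub_complete (R : realType) (V : completeNormedModType R[i])
    (A : csubspace V) (F : set_system A) :
  ProperFilter F -> cauchy F -> cvg F.
Proof.
move=> FF Fc.
have : cvg (@csub_val R V A @ F).
  apply: cauchy_cvg; apply/cauchyP => e e0.
  have /cauchyP/(_ e e0)[x Fx] := Fc.
  exists (csub_val x).
  rewrite -[_ (ball _ _)]/(F [set y : A | ball (csub_val x) e (csub_val y)]).
  apply: filterS Fx => y.
  by rewrite -!ball_normE.
set l := lim _ => Fl.
have lA : csub_set A l.
  apply: (@closed_cvg A V F FF (@csub_val R V A) (csub_set A) _ _ l Fl).
    exact: csub_set_closed.
  by apply: filterE => x; exact: csubP.
have lP : l \in csub_pred A by apply/asboolP.
apply/cvg_ex; exists (CSub lP); apply/cvgrPdist_lt => e e0.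
by have /cvgr_dist_lt /(_ _ e0) := Fl; apply: filterS.
Qed.

HB.instance Definition _ (R : realType) (V : completeNormedModType R[i])
  (A : csubspace V) := Uniform_isComplete.Build (csub A) (@csub_complete R V A).

Definition lft_domain (R : realType) (H K : hilbertType R)
    (A : csubspace (bop H K)) (C : bop K H) (D : bop H H) (Z0 : A) : set A :=
  connected_component
    [set Z : A | binvertible (bcomp C (csub_val Z) + D)] Z0.

Section Holomorphic.
Context {R : realType}.
Implicit Types V W : normedModType R[i].

(* Functions on a subset are represented by total functions, whose values
   outside the subset are irrelevant.  `differentiable` is complex Frechet
   differentiability because the scalar field is `R[i]`; it is a condition on
   the germ at z, so `holomorphic_on` is meant for open D. *)
Definition holomorphic_on V W (D : set V) (f : V -> W) :=
  forall z, D z -> differentiable f z.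

Definition is_domain V (D : set V) := [/\ D !=set0, open D & connected D].

Definition holo_equiv V W (D : set V) (E : set W) :=
  exists f : V -> W, [/\ holomorphic_on D f, set_bij D E f &
    exists g : W -> V, holomorphic_on E g /\ {in D, cancel f g}].

End Holomorphic.

(* Main.v *)
Require Import Defs.
From HB Require Import structures.
From mathcomp Require Import all_boot all_order all_algebra.
From mathcomp Require Import complex ring lra.
From mathcomp Require Import all_classical all_reals all_analysis.

Set Implicit Arguments.
Unset Strict Implicit.
Unset Printing Implicit Defensive.
Import Order.TTheory GRing.Theory Num.Theory.
Import numFieldNormedType.Exports.

Local Open Scope classical_set_scope.
Local Open Scope complex_scope.
Local Open Scope ring_scope.

(** Write [X_ Z = (C Z + D)^-1 C] for [Z] in the domain.  If [h] is bounded and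
    holomorphic on the domain, it is enough to show that its derivative vanishes
    everywhere, for then [h] is locally constant on a connected open set
    ([zero_diff_constant], [bounded_constant]).

    Suppose first that [V X_Z V] lies in the subspace for every [V] in it.  For
    [W] in the subspace and [T = X_Z W], polarization and the quadratic identity
    of Jordan algebras show that all [W T^k] lie in the subspace
    ([triple_pow_csub]), hence so do the values of the curve
    [psi m u = W ((1 + u T)^m - 1) / T], a polynomial in [u].  The pencil factors:
    [C (Z + psi m u) + D = (C Z + D) (1 + u T)^m].  For [|u| |T| <= 1/2] it is
    invertible, so [Z + psi m u] stays in the domain, for every [m].  The curve
    leaves [Z] with velocity [m W], so the Cauchy estimate for [h (Z + psi m u)]
    bounds [m |dh(Z) W|] independently of [m], whence [dh(Z) W = 0]
    ([bounded_diff0]).  In the limit, rescaling [u] by [m], the curve becomes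
    [W (exp (u T) - 1) / T], an entire curve through [Z] inside the domain, and
    the argument becomes the theorem of Liouville; polynomials make the operator
    exponential unnecessary.

    The assumption on [X_Z] is given at [Z0] only.  If it holds at [Z], it holds
    at [Z + W] for small [W], because [X_(Z+W) = (1 + X_Z W)^-1 X_Z] has a Neumann
    series whose terms preserve the closed subspace ([triple_closed_neumann]).
    The size allowed for [W] is locally uniform, so the step can be reversed:
    the set of such [Z] is open and closed in the connected domain, hence all of
    it ([dom_triple_closed]).

    The Cauchy estimate ([cauchy_estimate]) is proved for functions with values
    in a normed space that are merely differentiable, without integrals.  Riemann
    sums around a square with a fixed mesh are exactly additive under
    subdivision and exactly zero on affine functions, so bisection shows that
    they tend to 0 as the mesh is refined ([goursat]).  In logarithmic
    coordinates this says that means over concentric circles agree. *)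

Local Notation "T ∘ S" := (bcomp T S) (at level 40, left associativity).

(** * Real-valued norms and first-order expansions *)

Section RealNorm.
Context {R : realType}.
Implicit Types V W : normedZmodType R[i].

(** Norms take values in [R[i]], whose order is only partial; their real parts
    live in [R], where inequalities between reals can be decided. *)
Definition rnorm V (x : V) : R := complex.Re `|x|.

Lemma rnormK V (x : V) : (rnorm x)%:C = `|x|.
Proof. by rewrite /rnorm RRe_real// ger0_real. Qed.

Lemma rnorm_le V (x : V) (e : R) : (rnorm x <= e) = (`|x| <= e%:C).
Proof. by rewrite -rnormK lecR. Qed.

Lemma rnorm_lt V (x : V) (e : R) : (rnorm x < e) = (`|x| < e%:C).
Proof. by rewrite -rnormK ltcR. Qed.

Lemma rnorm_ge0 V (x : V) : 0 <= rnorm x.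
Proof. by rewrite -lecR rnormK normr_ge0. Qed.

Lemma rnorm0 V : rnorm (0 : V) = 0.
Proof. by rewrite /rnorm normr0. Qed.

Lemma rnorm_eq0 V (x : V) : (rnorm x == 0) = (x == 0).
Proof. by rewrite -(inj_eq (@complexI R)) rnormK normr_eq0. Qed.

Lemma rnormN V (x : V) : rnorm (- x) = rnorm x.
Proof. by rewrite /rnorm normrN. Qed.

Lemma rnormB V (x y : V) : rnorm (x - y) = rnorm (y - x).
Proof. by rewrite /rnorm distrC. Qed.

Lemma rnormD V (x y : V) : rnorm (x + y) <= rnorm x + rnorm y.
Proof. by rewrite -lecR rmorphD /= !rnormK ler_normD. Qed.

Lemma rnormDB V (x y : V) : rnorm (x - y) <= rnorm x + rnorm y.
Proof. by rewrite -[rnorm y]rnormN rnormD. Qed.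

Lemma rnormZ (V : normedModType R[i]) (a : R[i]) (x : V) :
  rnorm (a *: x) = rnorm a * rnorm x.
Proof. by apply: complexI; rewrite rmorphM /= !rnormK normrZ. Qed.

Lemma rnormM (a b : R[i]) : rnorm (a * b) = rnorm a * rnorm b.
Proof. by apply: complexI; rewrite rmorphM /= !rnormK normrM. Qed.

Lemma rnormV (a : R[i]) : rnorm a^-1 = (rnorm a)^-1.
Proof. by apply: complexI; rewrite fmorphV /= !rnormK normfV. Qed.

Lemma rnormC (x : R) : rnorm x%:C = `|x|.
Proof. by rewrite /rnorm normc_def /= expr0n addr0 sqrtr_sqr. Qed.

Lemma rnormi : rnorm ('i%C : R[i]) = 1.
Proof. by rewrite /rnorm normc_def /= expr0n add0r expr1n sqrtr1. Qed.

Lemma rnorm_nat n : rnorm (n%:R : R[i]) = n%:R.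
Proof. by rewrite /rnorm normr_nat raddfMn. Qed.

Lemma rnorm_Complex (x y : R) : rnorm (x +i* y) <= `|x| + `|y|.
Proof.
rewrite [_ +i* _]complexE /= (le_trans (rnormD _ _))//.
by rewrite rnormM rnormi mul1r !rnormC.
Qed.

Lemma Re_rnorm (z : R[i]) : `|complex.Re z| <= rnorm z.
Proof.
by rewrite /rnorm normc_def /= -sqrtr_sqr ler_wsqrtr// lerDl sqr_ge0.
Qed.

Lemma Im_rnorm (z : R[i]) : `|complex.Im z| <= rnorm z.
Proof.
by rewrite /rnorm normc_def /= -sqrtr_sqr ler_wsqrtr// lerDr sqr_ge0.
Qed.

Lemma rnorm_sum V (I : Type) (r : seq I) (P : pred I) (F : I -> V) :
  rnorm (\sum_(i <- r | P i) F i) <= \sum_(i <- r | P i) rnorm (F i).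
Proof.
elim/big_ind2: _ => //; first by rewrite rnorm0.
by move=> x1 x2 y1 y2 h1 h2; rewrite (le_trans (rnormD _ _))// lerD.
Qed.

Lemma pow_half_lt (c e : R) : 0 <= c -> 0 < e -> exists n, c * 2 ^- n < e.
Proof.
move=> c0 e0; have ce : 0 < e / (c + 1) by rewrite divr_gt0// ltr_wpDl.
exists (Num.Def.archi_bound (e / (c + 1))^-1).
have := realalg.RealAlg.upper_nthrootVP ce (leqnn _).
rewrite ltr_pdivlMr ?ltr_wpDl// mulrC; apply: le_lt_trans.
by rewrite ler_wpM2r ?invr_ge0 ?exprn_ge0// lerDl.
Qed.

Lemma rnorm_nbhs (V : normedModType R[i]) (x : V) (P : set V) :
  nbhs x P <-> exists2 d : R, 0 < d & forall y, rnorm (y - x) < d -> P y.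
Proof.
split=> [/nbhs_normP[e /= e0 He]|[d d0 Hd]].
  have eR : (complex.Re e)%:C = e by rewrite RRe_real// gtr0_real.
  exists (complex.Re e) => [|y yx]; first by rewrite -ltcR eR.
  by apply: He; rewrite /= distrC -eR -rnorm_lt.
apply/nbhs_normP; exists d%:C => /=; first by rewrite ltcR.
by move=> y /=; rewrite distrC -rnorm_lt; exact: Hd.
Qed.

Lemma differentiable_rnorm (V W : normedModType R[i]) (f : V -> W) x :
  differentiable f x ->
  forall e : R, 0 < e -> exists2 d : R, 0 < d & forall v, rnorm v < d ->
    rnorm (f (x + v) - f x - 'd f x v) <= e * rnorm v.
Proof.
move=> fx e e0.
have /eqaddoE/eqaddoP/(_ e%:C) := funext (diff_locallyxC fx).
rewrite ltcR => /(_ e0) /rnorm_nbhs[d d0 H].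
exists d => // v vd; rewrite rnorm_le rmorphM /= rnormK.
have := H v; rewrite subr0 => /(_ vd) /=.
by rewrite opprD addrA.
Qed.

End RealNorm.

(** * Goursat's lemma for Riemann sums *)

Section Goursat.
Context {R : realType} {X : normedModType R[i]}.
Implicit Types (F G : R[i]^o -> X) (a d z : R[i]).

Definition edge_sum F a d N : X := \sum_(k < N) F (a + k%:R / N%:R * d).

(** The left-endpoint Riemann sum of the contour integral of [F] around the
    square with corner [a] and sides [d] and ['i * d], each side being cut into
    [N] pieces.  With the mesh [d / N] kept fixed, it is exactly additive when the
    square is halved, it annihilates affine functions, and it is bounded by the
    perimeter times the supremum of [|F|]; the proof of Goursat uses no more of
    an integral, so no integration theory for vector-valued functions is
    involved. *)
Definition contour_sum F a d N : X :=
  (d / N%:R) *: (edge_sum F a d N - edge_sum F (a + 'i%C * d) d N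
    + 'i%C *: (edge_sum F (a + d) ('i%C * d) N - edge_sum F a ('i%C * d) N)).

Lemma edge_sum_double F a d N : edge_sum F a d (N + N) =
  edge_sum F a (d / 2) N + edge_sum F (a + d / 2) (d / 2) N.
Proof.
rewrite /edge_sum big_split_ord /=; congr (_ + _); apply: eq_bigr => k _.
  rewrite addnn -muln2 natrM invfM; congr (F (_ + _)).
  by rewrite !mulrA -!(mulrAC _ _ d) mulrAC.
have N0 : N%:R != 0 :> R[i] by rewrite pnatr_eq0; case: N k => [[]|].
rewrite addnn -muln2 natrM natrD -addrA; congr (F (_ + _)).
by field.
Qed.

(** The sums along the sides shared by two of the four quarters cancel. *)
Lemma contour_sum_double F a d N : contour_sum F a d (N + N) =
  contour_sum F a (d / 2) N + contour_sum F (a + d / 2) (d / 2) N +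
  (contour_sum F (a + 'i%C * (d / 2)) (d / 2) N +
   contour_sum F (a + d / 2 + 'i%C * (d / 2)) (d / 2) N).
Proof.
rewrite /contour_sum !edge_sum_double.
have -> : d / (N + N)%:R = d / 2 / N%:R.
  by rewrite addnn -muln2 natrM invfM mulrA mulrAC.
have -> : 'i%C * d / 2 = 'i%C * (d / 2) by rewrite mulrA.
have -> : a + 'i%C * d + d / 2 = a + d / 2 + 'i%C * (d / 2) + 'i%C * (d / 2) by field.
have -> : a + d + 'i%C * (d / 2) = a + d / 2 + 'i%C * (d / 2) + d / 2 by field.
have -> : a + 'i%C * d = a + 'i%C * (d / 2) + 'i%C * (d / 2) by field.
have -> : a + 'i%C * (d / 2) + d / 2 = a + d / 2 + 'i%C * (d / 2) by field.
have -> : a + d / 2 + d / 2 = a + d by field.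
rewrite -!scalerDr; congr (_ *: _).
rewrite !scalerBr !scalerDr.
(* [m1] to [m4] are the inner sides; each occurs with both signs. *)
set m1 := edge_sum F (a + 'i%C * _) _ N.
set m3 := edge_sum F (a + d / 2 + 'i%C * _) (d / 2) N.
set m2 := 'i%C *: edge_sum F (a + d / 2) ('i%C * _) N.
set m4 := 'i%C *: edge_sum F (a + d / 2 + 'i%C * _) ('i%C * _) N.
rewrite !opprD !addrA [RHS](ACl (1*5*10*14*7*15*4*12*3*8*9*2*11*16*13*6))%AC /=.
by rewrite !addrK.
Qed.

Lemma contour_sumB F G a d N :
  contour_sum (fun z => F z - G z) a d N =
  contour_sum F a d N - contour_sum G a d N.
Proof.
rewrite /contour_sum /edge_sum !sumrB -scalerBr; congr (_ *: _).
set e1 := \sum_(k < N) F _; set e2 := \sum_(k < N) G _.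
set e3 := \sum_(k < N) F _; set e4 := \sum_(k < N) G _.
set e5 := \sum_(k < N) F _; set e6 := \sum_(k < N) G _.
set e7 := \sum_(k < N) F _; set e8 := \sum_(k < N) G _.
rewrite !scalerBr !opprD !opprK !addrA.
by rewrite [LHS](ACl (1*3*5*7*2*4*6*8))%AC.
Qed.

Lemma edge_sum_shift F a u d N L : (forall z, F (z + u) = F z + L) ->
  edge_sum F (a + u) d N = edge_sum F a d N + N%:R *: L.
Proof.
move=> FL; rewrite /edge_sum.
have -> : N%:R *: L = \sum_(k < N) L by rewrite sumr_const card_ord scaler_nat.
by rewrite -big_split; apply: eq_bigr => k _ /=; rewrite addrAC FL.
Qed.

(** Translating an affine function changes it by a constant, so the opposite
    horizontal sides contribute [- 'i * d * d] times the slope and the vertical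
    ones ['i * d * d] times the slope; the left-endpoint rule makes this exact. *)
Lemma contour_sum_affine (P L : X) c a d N :
  contour_sum (fun z => P + (z - c) *: L) a d N = 0.
Proof.
pose G z := P + (z - c) *: L.
have GL u z : G (z + u) = G z + u *: L by rewrite /G addrAC scalerDl addrA.
rewrite /contour_sum (edge_sum_shift _ _ _ (GL ('i%C * d))).
rewrite (edge_sum_shift _ _ _ (GL d)).
rewrite opprD addNKr [_ + _ *: (d *: L) - _]addrAC subrr add0r.
rewrite !scalerA addrC -scalerBl [X in X *: L](_ : _ = 0); last by ring.
by rewrite scale0r scaler0.
Qed.

Lemma rnorm_edge_sum F a d N (B : R) :
  (forall t : R, 0 <= t <= 1 -> rnorm (F (a + t%:C * d)) <= B) ->
  rnorm (edge_sum F a d N) <= N%:R * B.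
Proof.
move=> FB; rewrite (le_trans (rnorm_sum _ _ _))//.
rewrite mulr_natl -[N in B *+ N]card_ord -sumr_const ler_sum// => k _.
have -> : k%:R / N%:R = (k%:R / N%:R)%:C :> R[i].
  by rewrite rmorphM fmorphV !rmorph_nat.
apply: FB; rewrite divr_ge0//= ler_pdivrMr ?mul1r ?ler_nat 1?ltnW//.
by rewrite ltr0n; case: N k => [[]|].
Qed.

Definition square a d : set R[i] :=
  [set a + (t.1 +i* t.2) * d | t in [set t : R * R | 0 <= t.1 <= 1 /\ 0 <= t.2 <= 1]].

Lemma rnorm_contour_sum F a d N (B : R) :
  (forall z, square a d z -> rnorm (F z) <= B) ->
  rnorm (contour_sum F a d N) <= 4 * rnorm d * B.
Proof.
move=> FB; rewrite /contour_sum rnormZ rnormM rnormV rnorm_nat.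
have B0 : 0 <= B.
  apply: le_trans (rnorm_ge0 _) (FB (a + (0 +i* 0) * d) _).
  by exists (0, 0) => //=; rewrite lexx ler01.
have [->|N0] := eqVneq N 0%N.
  by rewrite invr0 mulr0 mul0r mulr_ge0// mulr_ge0 ?rnorm_ge0.
have NR : 0 < N%:R :> R by rewrite ltr0n lt0n.
have E1 : rnorm (edge_sum F a d N) <= N%:R * B.
  apply: rnorm_edge_sum => t t01; apply: FB; exists (t, 0) => //=.
  by rewrite lexx ler01.
have E2 : rnorm (edge_sum F (a + 'i%C * d) d N) <= N%:R * B.
  apply: rnorm_edge_sum => t t01; apply: FB; exists (t, 1) => //=.
    by rewrite lexx ler01.
  by rewrite -addrA -mulrDl; congr (_ + _ * d); simpc.
have E3 : rnorm (edge_sum F (a + d) ('i%C * d) N) <= N%:R * B.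
  apply: rnorm_edge_sum => t t01; apply: FB; exists (1, t) => //=.
    by rewrite lexx ler01.
  by rewrite -addrA mulrA -[X in a + (X + _)]mul1r -mulrDl; congr (_ + _ * d); simpc.
have E4 : rnorm (edge_sum F a ('i%C * d) N) <= N%:R * B.
  apply: rnorm_edge_sum => t t01; apply: FB; exists (0, t) => //=.
    by rewrite lexx ler01.
  by rewrite mulrA; congr (_ + _ * d); simpc.
rewrite mulrAC ler_pdivrMr//.
rewrite [4 * _]mulrC -!mulrA ler_wpM2l ?rnorm_ge0//.
rewrite (le_trans (rnormD _ _))// rnormZ rnormi mul1r.
have := rnormDB (edge_sum F a d N) (edge_sum F (a + 'i%C * d) d N).
have := rnormDB (edge_sum F (a + d) ('i%C * d) N) (edge_sum F a ('i%C * d) N).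
lra.
Qed.

End Goursat.

Section GoursatBisection.
Context {R : realType} {X : normedModType R[i]}.
Implicit Types (F : R[i]^o -> X) (a d z : R[i]).

(** The conclusion of Goursat for a fixed [e], scaled by the area of the square
    so that it passes from the four quarters to the whole. *)
Definition small_contour F (e : R) a d :=
  exists n0, forall n, (n0 <= n)%N ->
    rnorm (contour_sum F a d (2 ^ n)%N) <= e * rnorm d ^+ 2.

Lemma rnorm_half d : rnorm (d / 2) = rnorm d / 2.
Proof. by rewrite rnormM rnormV rnorm_nat. Qed.

Lemma small_contour_quarters F e a d :
  (forall b c : bool,
     small_contour F e (a + ((b%:R +i* c%:R) * (d / 2))) (d / 2)) ->
  small_contour F e a d.
Proof.
have cE (b c : bool) : (b%:R +i* c%:R) * (d / 2) =
    b%:R * (d / 2) + c%:R * ('i%C * (d / 2)) :> R[i].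
  by rewrite [b%:R +i* _]complexE !rmorph_nat; ring.
move=> H.
have [n1 H1] := H false false; have [n2 H2] := H true false.
have [n3 H3] := H false true; have [n4 H4] := H true true.
exists (maxn (maxn n1 n2) (maxn n3 n4)).+1 => -[//|n]; rewrite ltnS !geq_max.
move=> /andP[/andP[/H1{}H1 /H2{}H2] /andP[/H3{}H3 /H4{}H4]].
rewrite expnS mul2n -addnn contour_sum_double.
rewrite !rnorm_half !cE !(mul0r, mul1r, add0r, addr0) ?addrA in H1 H2 H3 H4.
set c1 := contour_sum F a _ _ in H1 *.
set c2 := contour_sum F (a + d / 2) _ _ in H2 *.
set c3 := contour_sum F (a + 'i%C * (d / 2)) _ _ in H3 *.
set c4 := contour_sum F _ _ _ in H4 *.
have := rnormD (c1 + c2) (c3 + c4).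
have := rnormD c1 c2; have := rnormD c3 c4.
have -> : e * rnorm d ^+ 2 = 4 * (e * (rnorm d / 2) ^+ 2) by field.
lra.
Qed.

Lemma nested_intervals (x r : nat -> R) : (forall n, 0 <= r n) ->
  (forall n, x n <= x n.+1) -> (forall n, x n.+1 + r n.+1 <= x n + r n) ->
  exists y, forall n, x n <= y <= x n + r n.
Proof.
move=> r0 xx rr.
have xm : {homo x : m n / (m <= n)%N >-> m <= n}.
  by apply: homo_leq => // m n p; exact: le_trans.
have rm : {homo (fun n => - (x n + r n)) : m n / (m <= n)%N >-> m <= n}.
  apply: homo_leq => // [m n p|n]; [exact: (@le_trans _ _ _)|by rewrite lerN2].
have xr m n : x m <= x n + r n.
  apply: (@le_trans _ _ (x (maxn m n))); first by rewrite xm// leq_maxl.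
  apply: (@le_trans _ _ (x (maxn m n) + r (maxn m n))); first by rewrite lerDl.
  by rewrite -lerN2 rm// leq_maxr.
exists (sup (range x)) => n; apply/andP; split.
  by apply: ub_le_sup; [exists (x 0%N + r 0%N) => _ [m _ <-]|exists n].
by apply: ge_sup; [exists (x 0%N), 0%N|move=> _ [m _ <-]].
Qed.

(** Goursat by bisection, for Riemann sums: if the contour sums are not
    eventually small on the square, they are not on one of its quarters, and so
    on down to a point [z] of differentiability.  Near [z], [F] is affine up to
    an error at most a small multiple of the distance; the affine part
    contributes nothing, whatever the mesh, and the rest contributes at most a
    small multiple of the area: a contradiction. *)
Lemma goursat F a d : (forall z : R[i]^o, square a d z -> differentiable F z) ->
  forall e : R, 0 < e -> exists n0, forall n, (n0 <= n)%N ->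
    rnorm (contour_sum F a d (2 ^ n)%N) <= e * rnorm d ^+ 2.
Proof.
move=> Fdiff e e0; apply: contrapT => bad0.
pose corner (p : R * R * R) := a + (p.1.1 +i* p.1.2) * d.
(* A state [((x, y), r)] is the square with side ratio [r] and corner at
   relative position [x + i y]. *)
pose bad (p : R * R * R) := ~ small_contour F e (corner p) (p.2%:C * d).
pose step (p q : {p | bad p}) := exists b c : bool,
  sval q = (((sval p).1.1 + b%:R * ((sval p).2 / 2),
            (sval p).1.2 + c%:R * ((sval p).2 / 2)), (sval p).2 / 2).
have stepP p : {q | step p q}.
  apply: cid; case: p => [[[x y] r] p_bad].
  have [b [c qbad]] : exists b c : bool,
      bad ((x + b%:R * (r / 2), y + c%:R * (r / 2)), r / 2).
    apply: contrapT => allgood; apply: p_bad; apply: small_contour_quarters => b c.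
    apply: contrapT => Nsmall; apply: allgood; exists b, c.
    rewrite /bad /corner /=.
    have -> : (r / 2)%:C * d = r%:C * d / 2.
      by rewrite rmorphM fmorphV rmorph_nat mulrAC.
    suff -> : (x + b%:R * (r / 2)) +i* (y + c%:R * (r / 2)) =
        (x +i* y) + (b%:R +i* c%:R) * (r%:C / 2).
      by rewrite mulrDl -[_ * (r%:C / 2) * d]mulrA [r%:C / 2 * d]mulrAC addrA.
    rewrite (_ : r%:C / 2 = (r / 2)%:C); last by rewrite rmorphM fmorphV rmorph_nat.
    by simpc.
  by exists (exist _ _ qbad), b, c.
have bad00 : bad ((0, 0), 1).
  by rewrite /bad /corner /= mul1r (_ : 0 +i* 0 = 0)// mul0r addr0.
have [p [p0 pS]] := dependent_choice stepP (exist _ _ bad00).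
pose x n := (sval (p n)).1.1; pose y n := (sval (p n)).1.2.
pose r n := (sval (p n)).2.
have rE n : r n = 2 ^- n.
  elim: n => [|n IH]; first by rewrite /r p0 /= invr1.
  by have [b [c E]] := pS n; rewrite {1}/r E /= -/(r n) IH exprSr invfM.
have r0 n : 0 <= r n by rewrite rE invr_ge0 exprn_ge0.
have xS n : x n <= x n.+1 /\ x n.+1 + r n.+1 <= x n + r n.
  have [b [c E]] := pS n; rewrite {2 3}/x /r E /= -/(x n) -/(r n).
  by have := r0 n; case: b E => E /=; lra.
have yS n : y n <= y n.+1 /\ y n.+1 + r n.+1 <= y n + r n.
  have [b [c E]] := pS n; rewrite {2 3}/y /r E /= -/(y n) -/(r n).
  by have := r0 n; case: c E => E /=; lra.
have [x1 Hx] := nested_intervals r0 (fun n => (xS n).1) (fun n => (xS n).2).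
have [y1 Hy] := nested_intervals r0 (fun n => (yS n).1) (fun n => (yS n).2).
pose z : R[i]^o := a + (x1 +i* y1) * d.
have Fz : differentiable F z.
  apply: Fdiff; exists (x1, y1) => //=; have := Hx 0; have := Hy 0.
  by rewrite /x /y /r p0 /= !add0r.
(* Four sides of length |d'|, and distance at most 2 |d'| to [z]: hence 8. *)
have e80 : 0 < e / 8 by rewrite divr_gt0.
have [del del0 Hdel] := differentiable_rnorm Fz e80.
have [n rn] : exists n, r n * (2 * rnorm d) < del.
  have [n Hn] := pow_half_lt (mulr_ge0 (ler0n R 2) (rnorm_ge0 d)) del0.
  by exists n; rewrite rE mulrC.
have := svalP (p n); apply; exists 0%N => m _.
set c := corner _; set d' := _ * d.
have d'E : rnorm d' = r n * rnorm d by rewrite rnormM rnormC ger0_norm ?r0.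
pose L := 'd F z (1 : R[i]^o).
have -> : contour_sum F c d' (2 ^ m) =
    contour_sum (fun w => F w - (F z + (w - z) *: L)) c d' (2 ^ m).
  by rewrite contour_sumB contour_sum_affine subr0.
rewrite (le_trans (rnorm_contour_sum (B := e / 8 * (2 * rnorm d')) _ _))//; last first.
  by have := rnorm_ge0 d'; nra.
move=> _ [[s t] /= [s01 t01] <-]; set w := c + _.
have wz : w - z = ((x n + s * r n - x1) +i* (y n + t * r n - y1)) * d.
  transitivity (((x n +i* y n) + (s +i* t) * (r n)%:C - (x1 +i* y1)) * d).
    by rewrite /w /c /corner /z /d' /x /y /r; ring.
  by congr (_ * _); simpc.
have nwz : rnorm (w - z) <= 2 * rnorm d'.
  rewrite wz rnormM d'E mulrA ler_wpM2r ?rnorm_ge0//.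
  rewrite (le_trans (rnorm_Complex _ _))//.
  have := r0 n; have := Hx n; have := Hy n; have := s01; have := t01.
  move=> /andP[t1 t2] /andP[s1 s2] /andP[y3 y4] /andP[x3 x4] rn0.
  have := mulr_ge0 s1 rn0; have := ler_piMl rn0 s2.
  have := mulr_ge0 t1 rn0; have := ler_piMl rn0 t2 => a1 a2 a3 a4.
  have : `|x n + s * r n - x1| <= r n by rewrite ler_norml; apply/andP; split; lra.
  have : `|y n + t * r n - y1| <= r n by rewrite ler_norml; apply/andP; split; lra.
  lra.
rewrite opprD addrA.
have -> : (w - z) *: L = 'd F z (w - z).
  by rewrite /L -linearZ /=; congr ('d F z _); rewrite [_ *: _]mulr1.
have -> : F w = F (z + (w - z)) by rewrite addrC subrK.
rewrite (le_trans (Hdel _ _))//; last by rewrite ler_wpM2l// ltW.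
by rewrite (le_lt_trans nwz)// d'E mulrCA.
Qed.

End GoursatBisection.

(** * The complex exponential *)

Section ScaleRule.
Context {K : numFieldType} {V X : normedModType K}.

(** Scalar multiplication is viewed as a bilinear map so that the product rule
    for it is an instance of the rule for continuous bilinear maps. *)
Lemma scaler_is_bilinear : bilinear_for
  (GRing.Scale.Law.clone _ _ *:%R _) (GRing.Scale.Law.clone _ _ *:%R _)
  (( *:%R ) : K^o -> X -> X).
Proof.
by split=> [x|c] a y z /=; rewrite ?scalerDl ?scalerDr !scalerA// mulrC.
Qed.

HB.instance Definition _ :=
  bilinear_isBilinear.Build K K^o X X _ _ (( *:%R ) : K^o -> X -> X) scaler_is_bilinear.

Lemma differentiable_scale (k : V -> K^o) (f : V -> X) x :
  differentiable k x -> differentiable f x ->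
  differentiable (fun y => k y *: f y) x.
Proof.
move=> kx fx.
have kf := differentiable_pair kx fx.
apply: (@differentiable_comp _ _ _ _ (fun y => (k y, f y))
  (fun p : K^o * X => p.1 *: p.2)) => //.
by apply: (@differentiable_bilin _ _ _ _ ( *:%R : {bilinear K^o -> X -> X})) => p;
  exact: scale_continuous.
Qed.
End ScaleRule.

Section EpsilonDerivative.
Context {K : numFieldType} {X : normedModType K}.

Lemma eps_is_derive (f : K^o -> X) z (L : X) :
  (forall e, 0 < e -> exists2 d, 0 < d & forall h : K^o, `|h| < d ->
    `|f (z + h) - f z - h *: L| <= e * `|h|) ->
  is_derive z (1 : K^o) f L.
Proof.
move=> H.
have fL : h^-1 *: ((f \o shift z) (h *: (1 : K^o)) - f z) @[h --> 0^'] --> L.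
  apply/cvgrPdist_le => e e0; have [d d0 Hd] := H e e0.
  rewrite near_withinE; apply/nbhs_normP; exists d => // h /=.
  rewrite sub0r normrN => hd h0; rewrite [h%:A]mulr1 distrC.
  have -> : h^-1 *: (f (h + z) - f z) - L = h^-1 *: (f (z + h) - f z - h *: L).
    by rewrite addrC [RHS]scalerBr scalerA mulVf// scale1r addrC [z + h]addrC.
  by rewrite normrZ normfV mulrC ler_pdivrMr ?normr_gt0//; exact: Hd.
by split; [apply/cvg_ex; exists L|exact: cvg_lim].
Qed.

End EpsilonDerivative.

Section ComplexExponential.
Context {R : realType}.
Implicit Types (z w h : R[i]^o) (x u v e : R).

Lemma is_derive_eps (f : R -> R) x (l : R) : is_derive x 1 f l ->
  forall e, 0 < e -> exists2 d : R, 0 < d & forall u, `|u| < d ->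
    `|f (x + u) - f x - u * l| <= e * `|u|.
Proof.
move=> [fx fl] e e0.
have /eqaddoE/eqaddoP/(_ e e0)/nbhs_normP[d /= d0 H] := funext (derivable_nbhsx fx).
exists d => // u ud; have := H u; rewrite /= sub0r normrN => /(_ ud) /=.
by rewrite fl -[X in f (x + X)]mulr1 opprD addrA.
Qed.

Lemma eps_differentiable (X : normedModType R[i]) (f : R[i]^o -> X) z (L : X) :
  (forall e, 0 < e -> exists2 d : R, 0 < d & forall h, rnorm h < d ->
    rnorm (f (z + h) - f z - h *: L) <= e * rnorm h) ->
  differentiable f z.
Proof.
move=> H; apply/derivable1_diffP.
apply: (@ex_derive _ _ _ _ _ _ L); apply: eps_is_derive => e e0.
have eR : (complex.Re e)%:C = e by rewrite RRe_real// gtr0_real.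
have [d d0 Hd] := H (complex.Re e) ltac:(by rewrite -ltcR eR).
exists d%:C => [|h]; first by rewrite ltcR.
by rewrite -rnorm_lt => /Hd; rewrite rnorm_le rmorphM /= rnormK eR.
Qed.

Definition cexp z : R[i]^o :=
  (expR (complex.Re z))%:C * (cos (complex.Im z) +i* sin (complex.Im z)).

Lemma cexpD z w : cexp (z + w) = cexp z * cexp w.
Proof.
rewrite /cexp !raddfD /= expRD cosD sinD rmorphM.
have -> : (cos (complex.Im z) * cos (complex.Im w) - sin (complex.Im z) * sin (complex.Im w)) +i*
   (sin (complex.Im z) * cos (complex.Im w) + cos (complex.Im z) * sin (complex.Im w))
  = (cos (complex.Im z) +i* sin (complex.Im z)) * (cos (complex.Im w) +i* sin (complex.Im w)).
  by simpc; congr (_ +i* _); rewrite addrC.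
by rewrite mulrACA.
Qed.

Lemma rnorm_cexp z : rnorm (cexp z) = expR (complex.Re z).
Proof.
rewrite rnormM rnormC ger0_norm ?expR_ge0//.
by rewrite /rnorm normc_def /= cos2Dsin2 sqrtr1 mulr1.
Qed.

Lemma cexp0 : cexp 0 = 1.
Proof. by rewrite /cexp /= expR0 cos0 sin0 mul1r. Qed.

Lemma cexpNM z : cexp (- z) * cexp z = 1.
Proof. by rewrite -cexpD addNr cexp0. Qed.

Definition period : R[i]^o := 0 +i* (pi *+ 2).

Lemma cexp_period z : cexp (z + period) = cexp z.
Proof.
rewrite cexpD; have -> : cexp period = 1; last by rewrite mulr1.
by rewrite /cexp /= cos2pi sin2pi expR0 mul1r.
Qed.

(** The expansion at 0 follows from those of the three real functions: writing
    [h = u + i v], the real part of the error is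
    [(exp u - 1 - u) + exp u * (cos v - 1)] and the imaginary part is
    [exp u * (sin v - v) + (exp u - 1) * v]. *)
Lemma cexp_near0 e : 0 < e -> exists2 d : R, 0 < d & forall h, rnorm h < d ->
  rnorm (cexp h - 1 - h) <= e * rnorm h.
Proof.
(* With precision [k <= 1] in the three real expansions, [exp u <= 3] and
   [|exp u - 1| <= 2 k], so the four error terms sum to at most
   [(1 + 3 + 3 + 2) k |h|]. *)
move=> e0; pose k := Num.min 1 (e / 9).
have k0 : 0 < k by rewrite lt_min ltr01 divr_gt0.
have k1 : k <= 1 by rewrite ge_min lexx.
have ke : k <= e / 9 by rewrite ge_min lexx orbT.
clearbody k.
have [d1 d10 H1] := is_derive_eps (is_derive_expR (0 : R)) k0.
have [d2 d20 H2] := is_derive_eps (is_derive_sin (0 : R)) k0.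
have [d3 d30 H3] := is_derive_eps (is_derive_cos (0 : R)) k0.
exists (Num.min (Num.min d1 d2) (Num.min d3 k)).
  by rewrite !lt_min d10 d20 d30 k0.
move=> h; rewrite !lt_min => /andP[/andP[h1 h2] /andP[h3 hk]].
have := Re_rnorm h; have := Im_rnorm h.
set v := complex.Im h; set u := complex.Re h => vh uh.
have := H1 u (le_lt_trans uh h1); have := H2 v (le_lt_trans vh h2).
have := H3 v (le_lt_trans vh h3).
rewrite !add0r expR0 cos0 sin0 oppr0 !mulr0 !mulr1 ?(subr0, addr0) => c1 s1 e1.
have -> : cexp h - 1 - h =
    (expR u - 1 - u + expR u * (cos v - 1)) +i*
    (expR u * (sin v - v) + (expR u - 1) * v).
  rewrite (_ : h = u +i* v) ?/cexp /=; last by rewrite /u /v; case: (h).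
  by simpc; congr (_ +i* _); ring.
have [vn un] : `|v| <= rnorm h /\ `|u| <= rnorm h by [].
have n0 := rnorm_ge0 h.
have uk : `|u| < k := le_lt_trans uh hk.
have eu : `|expR u - 1| <= 2 * k.
  have -> : expR u - 1 = (expR u - 1 - u) + u by rewrite subrK.
  by rewrite (le_trans (ler_normD _ _))//; have := normr_ge0 u; nra.
have eu3 : `|expR u| <= 3.
  have -> : expR u = (expR u - 1) + 1 by rewrite subrK.
  by rewrite (le_trans (ler_normD _ _))// normr1; lra.
rewrite (le_trans (rnorm_Complex _ _))//.
have a1 := ler_normD (expR u - 1 - u) (expR u * (cos v - 1)).
have a2 := ler_normD (expR u * (sin v - v)) ((expR u - 1) * v).
rewrite !normrM in a1 a2.
have b1 : `|expR u| * `|cos v - 1| <= 3 * (k * rnorm h).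
  by rewrite ler_pM// (le_trans c1)// ler_wpM2l// ltW.
have b2 : `|expR u| * `|sin v - v| <= 3 * (k * rnorm h).
  by rewrite ler_pM// (le_trans s1)// ler_wpM2l// ltW.
have b3 : `|expR u - 1| * `|v| <= 2 * k * rnorm h by rewrite ler_pM.
have b4 : k * `|u| <= k * rnorm h by rewrite ler_wpM2l// ltW.
have b5 : k * rnorm h <= e / 9 * rnorm h by rewrite ler_wpM2r.
lra.
Qed.

Lemma differentiable_cexp z : differentiable cexp z.
Proof.
apply: (@eps_differentiable _ _ _ (cexp z)) => e e0.
have [d d0 Hd] := cexp_near0 (divr_gt0 e0 (expR_gt0 (complex.Re z))).
exists d => // h /Hd{}Hd.
have -> : cexp (z + h) - cexp z - h *: cexp z = cexp z * (cexp h - 1 - h).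
  by rewrite cexpD [h *: _]mulrC; ring.
rewrite rnormM rnorm_cexp mulrC -ler_pdivlMr ?expR_gt0// (le_trans Hd)//.
by rewrite mulrAC.
Qed.

End ComplexExponential.

(** * Cauchy's estimate *)

Section CauchyEstimate.
Context {R : realType} {X : normedModType R[i]}.
Implicit Types (F : R[i]^o -> X) (a z w : R[i]^o) (e B : R).

(** In the coordinate [z = exp w], this is a Riemann sum for the mean of a
    function over the circle of radius [exp (Re a)]. *)
Definition circle_mean F a N : X := N%:R^-1 *: edge_sum F a period N.

Lemma rnorm_circle_mean F a N (c : X) B : (0 < N)%N ->
  (forall z, complex.Re z = complex.Re a -> rnorm (F z - c) <= B) ->
  rnorm (circle_mean F a N - c) <= B.
Proof.
move=> N0 FB; have NR : 0 < N%:R :> R by rewrite ltr0n.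
have NC : N%:R != 0 :> R[i] by rewrite pnatr_eq0 -lt0n.
have -> : circle_mean F a N - c =
    N%:R^-1 *: edge_sum (fun z => F z - c) a period N.
  rewrite /circle_mean /edge_sum sumrB scalerBr; congr (_ - _).
  by rewrite sumr_const card_ord -[c *+ N]scaler_nat scalerA mulVf ?scale1r.
rewrite rnormZ rnormV rnorm_nat mulrC ler_pdivrMr// mulrC.
apply: rnorm_edge_sum => t _; apply: FB.
by case: a => x y /=; rewrite !(mul0r, mulr0, subr0, addr0).
Qed.

(** Goursat on the square between two vertical lines: by periodicity the two
    horizontal sides cancel, so the vertical sums agree in the limit.  The
    lines are at multiples of the period so that the region between any two of
    them is a union of squares one period high. *)
Lemma circle_mean_shift F : (forall w, F (w + period) = F w) ->
  (forall w, complex.Re w <= 0 -> differentiable F w) ->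
  forall (m : nat) e, 0 < e -> exists n0, forall n, (n0 <= n)%N ->
    rnorm (circle_mean F 0 (2 ^ n)%N -
           circle_mean F (- (m%:R * (pi *+ 2)))%:C (2 ^ n)%N) <= e.
Proof.
move=> Fper Fdiff; pose P : R := pi *+ 2.
have P0 : 0 < P by rewrite pmulrn_lgt0// pi_gt0.
elim=> [|m IH] e e0.
  by exists 0%N => n _; rewrite mul0r oppr0 subrr rnorm0 ltW.
have e20 : 0 < e / 2 by rewrite divr_gt0.
have [n1 H1] := IH _ e20.
pose a : R[i]^o := (- (m.+1%:R * P))%:C.
have Fsq (z : R[i]^o) : square a P%:C z -> differentiable F z.
  move=> [[s t] /= [/andP[s0 s1] t01] <-]; apply: Fdiff => /=.
  rewrite !(mul0r, mulr0, subr0, addr0).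
  have := mulr_ge0 (ler0n R m) (ltW P0); rewrite -natr1; nra.
have [n2 H2] := goursat Fsq (divr_gt0 e20 P0).
exists (maxn n1 n2) => n; rewrite geq_max => /andP[/H1{}H1 /H2{}H2].
set N := (2 ^ n)%N in H1 H2 *.
have iP : 'i%C * P%:C = period by rewrite /period -/P; simpc.
have aP : a + P%:C = (- (m%:R * P))%:C.
  by rewrite /a -rmorphD /= -natr1; congr (_%:C); ring.
have cE : contour_sum F a P%:C N = (P%:C * 'i%C) *:
    (circle_mean F (- (m%:R * P))%:C N - circle_mean F a N).
  rewrite /contour_sum iP aP.
  have -> : edge_sum F (a + period) P%:C N = edge_sum F a P%:C N.
    by apply: eq_bigr => k _; rewrite addrAC Fper.
  by rewrite subrr add0r -scalerBr !scalerA mulrAC.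
move: H2; rewrite cE rnormZ rnormM rnormi mulr1 rnormC gtr0_norm//.
rewrite expr2 mulrA divfK ?gt_eqF// mulrC ler_pM2r// => H2.
set m0 := circle_mean F 0 N in H1 *.
set m1 := circle_mean F _ N in H1 H2.
have -> : m0 - circle_mean F a N = (m0 - m1) + (m1 - circle_mean F a N).
  by rewrite addrA subrK.
by rewrite (le_trans (rnormD _ _))//; lra.
Qed.

(** The function [F w = exp (- w) * (f (r * exp w) - f 0)] is periodic and
    holomorphic on [Re w <= 0].  It is bounded by [2 * M] on [Re w = 0] and tends
    to [r * f' 0] as [Re w] tends to minus infinity, and its mean over a vertical
    period is the same on all vertical lines.  Removing the singularity of
    [(f z - f 0) / z] at 0 is thus replaced by moving it to infinity. *)
Lemma cauchy_estimate (f : R[i]^o -> X) (r M : R) : 0 < r ->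
  (forall z, rnorm z <= r -> differentiable f z) ->
  (forall z, rnorm z <= r -> rnorm (f z) <= M) ->
  r * rnorm ('d f (0 : R[i]^o) (1 : R[i]^o)) <= 2 * M.
Proof.
move=> r0 fdiff fM; set L := 'd f _ _.
pose F w := cexp (- w) *: (f (r%:C * cexp w) - f 0).
have rle w : complex.Re w <= 0 -> rnorm (r%:C * cexp w) <= r.
  by move=> w0; rewrite rnormM rnormC gtr0_norm// rnorm_cexp ger_pMr// -expR0 ler_expR.
have Fper w : F (w + period) = F w.
  rewrite /F cexp_period; congr (_ *: _).
  by rewrite -[LHS]cexp_period opprD subrK.
have Fdiff w : complex.Re w <= 0 -> differentiable F w.
  move=> w0; apply: differentiable_scale.
    apply: (@differentiable_comp _ _ _ _ (fun w : R[i]^o => - w) cexp).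
      exact: differentiableN.
    exact: differentiable_cexp.
  apply: (@differentiableB _ _ _ _ (cst (f 0))) => //.
  apply: (@differentiable_comp _ _ _ _ (fun w : R[i]^o => r%:C * cexp w : R[i]^o) f).
    exact: (@differentiableZ _ _ _ cexp r%:C w (differentiable_cexp w)).
  by apply: fdiff; exact: rle.
have f0 : differentiable f (0 : R[i]^o) by apply: fdiff; rewrite rnorm0 ltW.
have F0 z : complex.Re z = 0 -> rnorm (F z - 0) <= 2 * M.
  move=> z0; rewrite subr0 rnormZ rnorm_cexp raddfN /= z0 oppr0 expR0 mul1r.
  rewrite (le_trans (rnormDB _ _))// mulr_natl mulr2n lerD// fM//.
    by apply: rle; rewrite z0.
  by rewrite rnorm0 ltW.
apply/ler_addgt0Pr => e e0.
have e3 : 0 < e / 2 / r by rewrite !divr_gt0.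
have [d d0 Hd] := differentiable_rnorm f0 e3.
have [m Fm] : exists m : nat, forall z, complex.Re z = - (m%:R * (pi *+ 2)) ->
    rnorm (F z - r%:C *: L) <= e / 2.
  have P0 : 0 < pi *+ 2 :> R by rewrite pmulrn_lgt0// pi_gt0.
  exists (Num.Def.archi_bound (r / d / (pi *+ 2))) => z zE.
  have zre : rnorm (cexp z) < d / r.
    rewrite rnorm_cexp zE expRN -[d / r]invf_div ltf_pV2 ?posrE ?expR_gt0 ?divr_gt0//.
    apply: lt_le_trans (expR_ge1Dx _); rewrite ltr_wpDl// -ltr_pdivrMr//.
    by apply: archi_boundP; rewrite !divr_ge0// ltW.
  have -> : F z - r%:C *: L =
      cexp (- z) *: (f (0 + r%:C * cexp z) - f 0 - 'd f (0 : R[i]^o) (r%:C * cexp z)).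
    have -> : 'd f (0 : R[i]^o) (r%:C * cexp z) = (r%:C * cexp z) *: L.
      by rewrite /L -linearZ /=; congr ('d f _ _); rewrite [_ *: _]mulr1.
    by rewrite add0r [RHS]scalerBr scalerA [cexp (- z) * _]mulrCA cexpNM mulr1.
  have nd : rnorm (r%:C * cexp z : R[i]^o) < d.
    by rewrite rnormM rnormC gtr0_norm// mulrC -ltr_pdivlMr.
  rewrite rnormZ (le_trans (ler_wpM2l (rnorm_ge0 _) (Hd _ nd)))//.
  rewrite mulrCA -rnormM [cexp (- z) * _]mulrCA cexpNM mulr1 rnormC gtr0_norm//.
  by rewrite divfK// gt_eqF.
have [n0 Hn] := circle_mean_shift Fper Fdiff m (divr_gt0 e0 (ltr0n R 2)).
have N0 : (0 < 2 ^ n0)%N by rewrite expn_gt0.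
have := Hn _ (leqnn _); have := rnorm_circle_mean (a := 0) N0 F0.
have := rnorm_circle_mean (a := (- (m%:R * (pi *+ 2)))%:C) N0 Fm.
set m1 := circle_mean F _ _; set m2 := circle_mean F _ _.
rewrite subr0 => h1 h2 h3.
have -> : r * rnorm L = rnorm (m2 - (m2 - m1) - (m1 - r%:C *: L)).
  by rewrite subKr subKr rnormZ rnormC gtr0_norm.
have := rnormDB (m2 - (m2 - m1)) (m1 - r%:C *: L).
have := rnormDB m2 (m2 - m1); lra.
Qed.
End CauchyEstimate.

(** * Bounded operators and the Neumann series *)

Section GeometricCauchy.
Context {R : realType} {V : completeNormedModType R[i]}.

Lemma geometric_limit (u : nat -> V) :
  (forall n, rnorm (u n.+1 - u n) <= 2 ^- n) ->
  exists l : V, forall e : R, 0 < e ->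
    exists n0, forall n, (n0 <= n)%N -> rnorm (l - u n) <= e.
Proof.
move=> du; have dist n m : rnorm (u (n + m)%N - u n) <= 2 * 2 ^- n - 2 * 2 ^- (n + m).
  elim: m => [|m IH].
    by rewrite addn0 !subrr rnorm0.
  rewrite addnS -(subrK (u (n + m)%N) (u _.+1)) -addrA (le_trans (rnormD _ _))//.
  have := du (n + m)%N; move: IH; rewrite [2 ^+ (n + m).+1]exprSr invfM; lra.
have small e : 0 < e -> exists n0, forall n, (n0 <= n)%N -> rnorm (u n0 - u n) < e.
  move=> e0; have [n0 Hn0] := pow_half_lt (ler0n R 2) e0.
  exists n0 => n /subnKC <-; rewrite rnormB (le_lt_trans (dist _ _))//.
  by rewrite (le_lt_trans _ Hn0)// gerBl mulr_ge0// invr_ge0 exprn_ge0.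
have ucvg : cvg (u @ \oo).
  apply: cauchy_cvg; apply/cauchyP => e e0.
  have eR : (complex.Re e)%:C = e by rewrite RRe_real// gtr0_real.
  have [n0 Hn0] := small (complex.Re e) ltac:(by rewrite -ltcR eR).
  exists (u n0); exists n0 => // n /= /Hn0.
  by rewrite rnorm_lt eR -ball_normE.
exists (lim (u @ \oo)) => e e0.
have /cvgrPdist_le/(_ e%:C) := ucvg; rewrite ltcR => /(_ e0)[n0 _ Hn0].
by exists n0 => n /Hn0; rewrite rnorm_le.
Qed.
End GeometricCauchy.

Section OperatorAlgebra.
Context {R : realType}.
Implicit Types U V W Y : normedModType R[i].

Lemma bop_ext U V (T S : bop U V) : (forall x, T x = S x) -> T = S.
Proof. by move=> TS; apply: val_inj; apply/funext. Qed.

Lemma bcompA U V W Y (T : bop W Y) (S : bop V W) (Q : bop U V) :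
  T ∘ (S ∘ Q) = T ∘ S ∘ Q.
Proof. exact: bop_ext. Qed.

Lemma bcompDl U V W (T S : bop V W) (Q : bop U V) : (T + S) ∘ Q = T ∘ Q + S ∘ Q.
Proof. exact: bop_ext. Qed.

Lemma bcompDr U V W (T : bop V W) (S Q : bop U V) : T ∘ (S + Q) = T ∘ S + T ∘ Q.
Proof. by apply: bop_ext => x; exact: bopD. Qed.

Lemma bcompZl U V W a (T : bop V W) (Q : bop U V) : (a *: T) ∘ Q = a *: (T ∘ Q).
Proof. exact: bop_ext. Qed.

Lemma bcompZr U V W a (T : bop V W) (Q : bop U V) : T ∘ (a *: Q) = a *: (T ∘ Q).
Proof. by apply: bop_ext => x; exact: bopZ. Qed.

Lemma bcompNl U V W (T : bop V W) (Q : bop U V) : (- T) ∘ Q = - (T ∘ Q).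
Proof. exact: bop_ext. Qed.

Lemma bcompNr U V W (T : bop V W) (Q : bop U V) : T ∘ (- Q) = - (T ∘ Q).
Proof. by rewrite -[- Q]scaleN1r -[RHS]scaleN1r bcompZr. Qed.

Lemma bcomp1l U V (T : bop U V) : bid ∘ T = T. Proof. exact: bop_ext. Qed.
Lemma bcomp1r U V (T : bop U V) : T ∘ bid = T. Proof. exact: bop_ext. Qed.

Lemma rnorm_bcomp U V W (T : bop V W) (Q : bop U V) :
  rnorm (T ∘ Q) <= rnorm T * rnorm Q.
Proof.
rewrite rnorm_le rmorphM /= !rnormK; apply: opnorm_le.
  by rewrite mulr_ge0.
move=> x; rewrite -mulrA; apply: le_trans (le_opnorm T (Q x)) _.
by apply: ler_wpM2l; [exact: opnorm_ge0|exact: le_opnorm].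
Qed.

Lemma rnorm_bid U : rnorm (bid : bop U U) <= 1.
Proof. by rewrite rnorm_le; apply: opnorm_le => // x; rewrite mul1r. Qed.

Lemma rnorm_small_eq0 V (x : V) : (forall e : R, 0 < e -> rnorm x <= e) -> x = 0.
Proof.
move=> H; apply/eqP; rewrite -rnorm_eq0 eq_le rnorm_ge0 andbT.
by apply/ler_addgt0Pr => e /H; rewrite add0r.
Qed.

(** The partial sums [S] of the Neumann series satisfy the recursion
    [S n.+1 = 1 - T S n] and commute with [T]; both facts pass to the limit. *)
Lemma neumann_inverse (U : completeNormedModType R[i]) (T : bop U U) :
  rnorm T <= 1 / 2 -> binvertible (bid + T).
Proof.
move=> T2; pose u n : bop U U := iter n (fun S => bid - T ∘ S) 0.
have uS n : u n.+1 = bid - T ∘ u n by [].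
have uT n : T ∘ u n = u n ∘ T.
  elim: n => [|n IH].
    by apply: bop_ext => x; exact: bop0.
  by rewrite uS bcompDr bcompDl bcompNr bcompNl bcomp1r bcomp1l -bcompA IH.
have du n : rnorm (u n.+1 - u n) <= 2 ^- n.
  elim: n => [|n IH].
    rewrite subr0 uS (_ : T ∘ u 0 = 0) ?subr0 ?expr0 ?invr1 ?rnorm_bid//.
    by apply: bop_ext => x; exact: bop0.
  have -> : u n.+2 - u n.+1 = - (T ∘ (u n.+1 - u n)).
    by rewrite bcompDr bcompNr {1}uS [in RHS]opprB
      [u n.+1 in X in _ - X]uS opprB addrC addrA subrK addrC.
  rewrite rnormN (le_trans (rnorm_bcomp _ _))// exprS invfM.
  by rewrite ler_pM ?rnorm_ge0// -[2^-1]mul1r.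
have [S HS] := geometric_limit du.
have TS : T ∘ S = S ∘ T.
  apply/eqP; rewrite -subr_eq0; apply/eqP/rnorm_small_eq0 => e e0.
  have [n /(_ _ (leqnn _)) Hn] := HS e e0.
  have -> : T ∘ S - S ∘ T = T ∘ (S - u n) - (S - u n) ∘ T.
    by rewrite bcompDr bcompDl bcompNr bcompNl opprD opprK addrACA uT addNr addr0.
  rewrite (le_trans (rnormDB _ _))//.
  have := rnorm_bcomp T (S - u n); have := rnorm_bcomp (S - u n) T.
  by have := rnorm_ge0 T; have := rnorm_ge0 (S - u n); nra.
have SE : S + T ∘ S = bid.
  apply/eqP; rewrite -subr_eq0; apply/eqP/rnorm_small_eq0 => e e0.
  have [n Hn] := HS (e / 2) (divr_gt0 e0 (ltr0n R 2)).
  have Hn1 := Hn _ (leqnn _); have Hn2 := Hn _ (leqnSn _).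
  have -> : S + T ∘ S - bid = (S - u n.+1) + T ∘ (S - u n).
    by rewrite uS bcompDr bcompNr opprB !addrA [RHS](ACl (1*4*3*(2*5)))%AC /= subrr addr0.
  rewrite (le_trans (rnormD _ _))//.
  have := rnorm_bcomp T (S - u n).
  by have := rnorm_ge0 T; have := rnorm_ge0 (S - u n); nra.
exists S; split; first by rewrite bcompDl bcomp1l.
by rewrite bcompDr bcomp1r -TS.
Qed.

Lemma binvertible_bcomp U (T S : bop U U) :
  binvertible T -> binvertible S -> binvertible (T ∘ S).
Proof.
move=> [T' [TT' T'T]] [S' [SS' S'S]]; exists (S' ∘ T'); split.
  by rewrite bcompA -[T ∘ S ∘ S']bcompA SS' bcomp1r.
by rewrite bcompA -[S' ∘ T' ∘ T]bcompA T'T bcomp1r.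
Qed.

End OperatorAlgebra.

(** * Subspaces closed under a triple product *)

Section TripleClosed.
Context {R : realType} {H K : normedModType R[i]}.
Context (A : csubspace (bop H K)).
Implicit Types (V W Z : bop H K) (X Y : bop K H).

(** Condition on [X] under which the subspace is a Jordan algebra for the product
    [V X W + W X V]. *)
Definition triple_closed X := forall V, csub_set A V -> csub_set A (V ∘ X ∘ V).

Lemma csub_setZ a V : csub_set A V -> csub_set A (a *: V).
Proof.
by move=> AV; have := csub_set_linear a AV (csub_set0 A); rewrite addr0.
Qed.

Lemma csub_setD V W : csub_set A V -> csub_set A W -> csub_set A (V + W).
Proof. by move=> AV AW; have := csub_set_linear 1 AV AW; rewrite scale1r. Qed.

Lemma csub_setB V W : csub_set A V -> csub_set A W -> csub_set A (V - W).
Proof.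
by move=> AV AW; apply: csub_setD => //; rewrite -scaleN1r; exact: csub_setZ.
Qed.

Lemma csub_set_approx V :
  (forall e : R, 0 < e -> exists2 W, csub_set A W & rnorm (V - W) < e) ->
  csub_set A V.
Proof.
move=> VA; apply: csub_set_closed => B /rnorm_nbhs[d d0 HB].
by have [W AW Wd] := VA d d0; exists W; split => //; apply: HB; rewrite rnormB.
Qed.

Lemma triple_polar X V W : triple_closed X -> csub_set A V -> csub_set A W ->
  csub_set A (V ∘ X ∘ W + W ∘ X ∘ V).
Proof.
move=> XA AV AW.
have -> : V ∘ X ∘ W + W ∘ X ∘ V =
    (V + W) ∘ X ∘ (V + W) - V ∘ X ∘ V - W ∘ X ∘ W.
  rewrite !(bcompDl, bcompDr) !addrA [RHS](ACl (2*3*(1*5)*(4*6)))%AC /=.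
  by rewrite !subrr !addr0 addrC.
by do 2?[apply: csub_setB; last exact: XA]; apply: XA; exact: csub_setD.
Qed.

(** The identity expressing the quadratic operator of a Jordan algebra by its
    product: with [V . W = V X W + W X V], twice [V X W X V] is
    [V . (V . W) - (V X V) . W]. *)
Lemma triple_quadratic X V W : triple_closed X -> csub_set A V -> csub_set A W ->
  csub_set A (V ∘ X ∘ W ∘ X ∘ V).
Proof.
move=> XA AV AW; set Q := _ ∘ V.
have QE : Q = 2^-1 *:
    ((V ∘ X ∘ (V ∘ X ∘ W + W ∘ X ∘ V) + (V ∘ X ∘ W + W ∘ X ∘ V) ∘ X ∘ V) -
     (V ∘ X ∘ V ∘ X ∘ W + W ∘ X ∘ (V ∘ X ∘ V))).
  rewrite !(bcompDl, bcompDr) !bcompA -/Q opprD !addrA.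
  rewrite [X in _ *: X](ACl (2*3*(1*5)*(4*6)))%AC /= !subrr !addr0.
  by rewrite -[Q + Q]mulr2n -[Q *+ 2]scaler_nat scalerA mulVf ?scale1r// pnatr_eq0.
rewrite QE; apply/csub_setZ/csub_setB; apply: triple_polar => //.
  exact: triple_polar.
exact: XA.
Qed.

(** The Jordan powers [W (X W)^n]. *)
Fixpoint triple_pow X W n : bop H K :=
  if n is n'.+1 then W ∘ X ∘ triple_pow X W n' else W.

Lemma triple_powSr X W n : triple_pow X W n.+1 = triple_pow X W n ∘ X ∘ W.
Proof.
elim: n => // n IH.
by rewrite -[LHS]/(W ∘ X ∘ triple_pow X W n.+1) [in LHS]IH /= !bcompA.
Qed.

(** Induction in steps of two: [W (X W)^(n+2)] is the quadratic operator of [W]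
    applied to [W (X W)^n]. *)
Lemma triple_pow_csub X W n : triple_closed X -> csub_set A W ->
  csub_set A (triple_pow X W n).
Proof.
move=> XA AW; suff : csub_set A (triple_pow X W n) /\ csub_set A (triple_pow X W n.+1).
  by case.
elim: n => [|n [IH1 IH2]]; split => //; first exact: XA.
have -> : triple_pow X W n.+2 = W ∘ X ∘ triple_pow X W n ∘ X ∘ W.
  by rewrite -[LHS]/(W ∘ X ∘ triple_pow X W n.+1) triple_powSr !bcompA.
exact: triple_quadratic.
Qed.

(** Here [Y = (1 + X W)^-1 X].  Expanding by the Neumann series,
    [V Y V] is the alternating sum of [V (X W)^n X V]; for [n > 0] this term is the
    quadratic operator of [V] applied to the Jordan power [W (X W)^(n-1)], so it
    lies in the subspace, and the remainders tend to 0. *)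
Lemma triple_closed_neumann X Y W : triple_closed X -> csub_set A W ->
  rnorm (X ∘ W) <= 1 / 2 -> (bid + X ∘ W) ∘ Y = X -> triple_closed Y.
Proof.
move=> XA AW XW2 XYE V AV.
have YE : Y = X - X ∘ W ∘ Y by rewrite -{1}XYE bcompDl bcomp1l addrK.
pose rem n := V ∘ iter n (bcomp (X ∘ W)) Y ∘ V.
have remE n : exists2 B, csub_set A B & V ∘ Y ∘ V = B + (-1) ^+ n *: rem n.
  elim: n => [|n [B AB ->]].
    by exists 0; [exact: csub_set0|rewrite add0r expr0 scale1r].
  have iE : iter n (bcomp (X ∘ W)) Y =
      iter n (bcomp (X ∘ W)) X - iter n.+1 (bcomp (X ∘ W)) Y.
    elim: n {AB} => [|n IH]; first exact: YE.
    by rewrite [LHS]/= IH bcompDr bcompNr.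
  exists (B + (-1) ^+ n *: (V ∘ iter n (bcomp (X ∘ W)) X ∘ V)).
    apply: csub_setD => //; apply: csub_setZ.
    case: n {AB iE} => [|n]; first exact: XA.
    have -> : iter n.+1 (bcomp (X ∘ W)) X = X ∘ triple_pow X W n ∘ X.
      elim: n => [//|n IH]; rewrite iterS IH /= !bcompA //.
    rewrite !bcompA; apply: triple_quadratic => //.
    exact: triple_pow_csub.
  rewrite -addrA; congr (_ + _); rewrite exprS mulN1r scaleNr -scalerBr.
  by congr (_ *: _); rewrite /rem [in LHS]iE bcompDr bcompNr bcompDl bcompNl.
have rem_le n : rnorm (rem n) <= rnorm V * rnorm Y * rnorm V * 2 ^- n.
  have itn : rnorm (iter n (bcomp (X ∘ W)) Y) <= 2 ^- n * rnorm Y.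
    elim: n => [|n IH]; first by rewrite expr0 invr1 mul1r.
    rewrite iterS (le_trans (rnorm_bcomp _ _))// exprS invfM -mulrA.
    by rewrite ler_pM ?rnorm_ge0// -[2^-1]mul1r.
  rewrite (le_trans (rnorm_bcomp _ _))// [leRHS]mulrAC ler_wpM2r ?rnorm_ge0//.
  rewrite (le_trans (rnorm_bcomp _ _))// -mulrA ler_wpM2l ?rnorm_ge0//.
  by rewrite mulrC.
apply: csub_set_approx => e e0.
have c0 : 0 <= rnorm V * rnorm Y * rnorm V by rewrite !mulr_ge0 ?rnorm_ge0.
have [n Hn] := pow_half_lt c0 e0; have [B AB BE] := remE n.
exists B => //; rewrite BE [B + _]addrC addrK rnormZ.
have -> : rnorm ((-1) ^+ n : R[i]) = 1.
  by rewrite /rnorm normrX normrN1 expr1n.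
by rewrite mul1r (le_lt_trans (rem_le n)).
Qed.

(** The binomial formula for [(1 + u X W)^m], each [(X W)^(k+1)] being factored as
    [X] times the Jordan power [W (X W)^k]. *)
Lemma triple_pow_binomial X W m (u : R[i]) :
  bid + X ∘ \sum_(k < m) ('C(m, k.+1)%:R * u ^+ k.+1) *: triple_pow X W k =
  iter m (bcomp (bid + u *: (X ∘ W))) bid.
Proof.
elim: m => [|m IH].
  by rewrite big_ord0 (_ : X ∘ 0 = 0) ?addr0//; apply: bop_ext => x; exact: bop0.
rewrite iterS -IH; set S := \sum_(k < m) _.
have -> : \sum_(k < m.+1) ('C(m.+1, k.+1)%:R * u ^+ k.+1) *: triple_pow X W k =
    S + (u *: W + u *: (W ∘ X ∘ S)).
  have -> : u *: W + u *: (W ∘ X ∘ S) =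
      \sum_(k < m.+1) ('C(m, k)%:R * u ^+ k.+1) *: triple_pow X W k.
    rewrite big_ord_recl /= bin0 mul1r; congr (_ + _).
    rewrite /S; elim/big_rec2: _ => [|k x y _ <-].
      by rewrite (_ : W ∘ X ∘ 0 = 0) ?scaler0//; apply: bop_ext => x; exact: bop0.
    by rewrite bcompDr scalerDr bcompZr scalerA /bump /= add1n mulrCA -exprS.
  have -> : S = \sum_(k < m.+1) ('C(m, k.+1)%:R * u ^+ k.+1) *: triple_pow X W k.
    by rewrite big_ord_recr /= bin_small// mul0r scale0r addr0.
  rewrite -big_split /=; apply: eq_bigr => k _.
  by rewrite -scalerDl -mulrDl -natrD -binS.
rewrite [in RHS]bcompDl bcomp1l [in RHS]bcompDr !bcompZl bcomp1r.
by rewrite !bcompDr !bcompZr !bcompA !addrA.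
Qed.

End TripleClosed.

(** * Locally constant functions and paths *)

Section LocallyConstant.
Context {R : realType}.
Implicit Types U V X : normedModType R[i].

(** The points of [B] where [Q] holds, and those where it fails, are both
    relatively open. *)
Lemma connected_locally_invariant (T : topologicalType) (B : set T)
    (Q : T -> Prop) (x : T) : connected B -> B x -> Q x ->
  (forall y, B y -> \forall z \near y, B z -> (Q z <-> Q y)) ->
  forall y, B y -> Q y.
Proof.
move=> Bconn Bx Qx Qloc.
suff BQ : B `&` [set y | Q y] = B by move=> y; rewrite -{1}BQ => -[].
apply: Bconn.
- by exists x.
- exists (interior [set y | B y -> Q y]); first exact: open_interior.
  apply/seteqP; split=> [y [By Qy]|y [By /interior_subset Qy]].
    by split => //; apply: filterS (Qloc y By) => z /[swap] Bz /(_ Bz)[_]; exact.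
  by split => //; exact: Qy.
- exists (~` interior [set y | B y -> ~ Q y]).
    exact/open_closedC/open_interior.
  apply/seteqP; split=> [y [By Qy]|y [By NQ]].
    by split => // /interior_subset/(_ By); exact.
  split => //=; apply: contrapT => NQy; apply: NQ.
  by apply: filterS (Qloc y By) => z /[swap] Bz /(_ Bz)[+ _] Qz => /(_ Qz).
Qed.

Lemma real_complex_continuous : continuous (fun t : R => t%:C : R[i]^o).
Proof.
move=> t; apply/cvgrPdist_lt => e e0.
have eR : (complex.Re e)%:C = e by rewrite RRe_real// gtr0_real.
apply/nbhs_normP; exists (complex.Re e) => /= [|s]; first by rewrite -ltcR eR.
by rewrite -eR -rnorm_lt -rmorphB rnormC.
Qed.

(** The curve [t |-> g (t * v)] on the unit interval joins [g 0] to [g v]. *)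
Lemma connected_component_path U V (S : set V) (g : U -> V) (v : U) :
  (forall t : R, 0 <= t <= 1 ->
     S (g (t%:C *: v)) /\ {for t%:C *: v, continuous g}) ->
  connected_component S (g 0) (g v).
Proof.
move=> Sg; pose p (t : R) := g (t%:C *: v).
have p0 : p 0 = g 0 by rewrite /p scale0r.
have p1 : p 1 = g v by rewrite /p scale1r.
have m0 : `[0, 1]%classic (0 : R) by rewrite /= in_itv /= lexx ler01.
have m1 : `[0, 1]%classic (1 : R) by rewrite /= in_itv /= lexx ler01.
rewrite -p0 -p1; exists (p @` `[0, 1]); last by exists 1.
split; first by exists 0.
  by move=> _ [t t01 <-]; move: t01; rewrite /= in_itv /= => /Sg[].
apply: connected_continuous_connected; first exact: segment_connected.
apply: continuous_in_subspaceT => t; rewrite inE /= in_itv /= => t01.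
have [_ gt] := Sg t t01; apply: continuous_comp; last exact: gt.
apply: (@continuous_comp _ _ _ (fun t : R => t%:C : R[i]^o) (fun a => a *: v)).
  exact: real_complex_continuous.
exact: scalel_continuous.
Qed.

Lemma rnorm_segment V (v : V) (t d : R) :
  0 <= t <= 1 -> rnorm v < d -> rnorm (t%:C *: v) < d.
Proof.
move=> /andP[t0 t1]; apply: le_lt_trans.
by rewrite rnormZ rnormC ger0_norm// ler_piMl// rnorm_ge0.
Qed.

Lemma connected_component_ball V (S : set V) x (d : R) : 0 < d ->
  (forall y, rnorm (y - x) < d -> S y) ->
  forall y, rnorm (y - x) < d -> connected_component S x y.
Proof.
move=> d0 Sd y yd.
have := @connected_component_path V V S (fun w => x + w) (y - x).
rewrite addr0 [x + (y - x)]addrC subrK; apply => t t01; split.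
  by apply: Sd; rewrite addrC addKr; exact: rnorm_segment.
by apply: (@continuousD _ _ _ (cst x) id); [exact: cst_continuous|].
Qed.

(** There is no mean value theorem for vector-valued functions, but the real
    function [t |-> |h (x + t v) - h x|] has derivative 0 on the unit interval, by
    the reverse triangle inequality, and vanishes at 0. *)
Lemma zero_diff_constant V X (h : V -> X) x (d : R) :
  (forall y, rnorm (y - x) < d ->
     differentiable h y /\ forall v, 'd h y v = 0) ->
  forall y, rnorm (y - x) < d -> h y = h x.
Proof.
move=> h0 y yd; set v := y - x in yd.
pose p (t : R) := x + t%:C *: v.
have pball t : 0 <= t <= 1 -> rnorm (p t - x) < d.
  by move=> t01; rewrite addrC addKr; exact: rnorm_segment.
pose g (t : R) := rnorm (h (p t) - h x).
have gd (t : R) : 0 <= t <= 1 -> is_derive t (1 : R) g 0.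
  move=> /pball/h0[ht dt0]; apply: eps_is_derive => e e0.
  have v1 : 0 < rnorm v + 1 by rewrite ltr_wpDl// rnorm_ge0.
  have [d1 d10 H] := differentiable_rnorm ht (divr_gt0 e0 v1).
  exists (d1 / (rnorm v + 1)) => [|u]; first by rewrite divr_gt0.
  rewrite ltr_pdivlMr// => ud.
  have nuv : rnorm (u%:C *: v) <= `|u| * (rnorm v + 1).
    by rewrite rnormZ rnormC ler_wpM2l// lerDl.
  have := H _ (le_lt_trans nuv ud); rewrite dt0 subr0 => Hu.
  rewrite scaler0 subr0.
  apply: (@le_trans _ _ (rnorm (h (p t + u%:C *: v) - h (p t)))).
    have -> : p t + u%:C *: v = p (t + u).
      by rewrite /p rmorphD /= scalerDl addrA.
    rewrite /g ler_norml; apply/andP; split.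
      have := rnormD (h (p t) - h (p (t + u))) (h (p (t + u)) - h x).
      by rewrite addrA subrK [rnorm (h (p t) - h (p _))]rnormB; lra.
    have := rnormD (h (p (t + u)) - h (p t)) (h (p t) - h x).
    by rewrite addrA subrK; lra.
  apply: le_trans Hu _; apply: le_trans (ler_wpM2l _ nuv) _.
    by rewrite divr_ge0// ltW.
  by rewrite mulrCA divfK ?gt_eqF// mulrC.
have [|| t _ gt] := @MVT_segment R g (cst 0) 0 1 ler01.
- by move=> t; rewrite in_itv /= => /andP[t0 t1]; apply: gd; rewrite !ltW.
- apply: continuous_in_subspaceT => t; rewrite inE /= in_itv /= => /gd gt.
  by apply/differentiable_continuous/derivable1_diffP; exact: ex_derive.
move: gt; rewrite mul0r /g /p scale0r scale1r addr0 subrr rnorm0 subr0.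
by rewrite /v [x + (y - x)]addrC subrK => /eqP; rewrite rnorm_eq0 subr_eq0 => /eqP.
Qed.

End LocallyConstant.

(** * Polynomial curves *)

Section PowerCurve.
Context {R : realType} {V : normedModType R[i]}.
Implicit Types (w : nat -> V) (u : R[i]^o).

(** The curve [((1 + u T)^m - 1) / T] with the operators multiplying the powers
    of [u] replaced by arbitrary coefficients [w k]. *)
Definition power_curve w m u : V :=
  \sum_(k < m) ('C(m, k.+1)%:R * u ^+ k.+1) *: w k.

(** Factoring out [u] makes the derivative at 0 the value of a continuous
    function. *)
Definition power_slope w m u : V :=
  \sum_(k < m) ('C(m, k.+1)%:R * u ^+ k) *: w k.

Lemma power_curveE w m u : power_curve w m u = u *: power_slope w m u.
Proof.
rewrite scaler_sumr; apply: eq_bigr => k _.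
by rewrite scalerA mulrCA -exprS.
Qed.

Lemma differentiable_power n u : differentiable (fun z : R[i]^o => z ^+ n : R[i]^o) u.
Proof.
elim: n => [|n IH]; first exact: differentiable_cst.
rewrite (_ : (fun z => _) = fun z : R[i]^o => z *: (z ^+ n : R[i]^o)).
  exact: (differentiable_scale (k := id)).
by apply/funext => z; rewrite exprS.
Qed.

Lemma differentiable_power_slope w m u : differentiable (power_slope w m) u.
Proof.
have -> : power_slope w m =
    \sum_(k < m) (fun u : R[i]^o => ('C(m, k.+1)%:R * u ^+ k) *: w k).
  by apply/funext => z; rewrite fct_sumE.
apply: differentiable_sum => k; apply: differentiableZl.
exact: (@differentiableZ _ _ _ (fun z : R[i]^o => z ^+ k : R[i]^o) _ _
  (differentiable_power k u)).
Qed.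

Lemma differentiable_power_curve w m u : differentiable (power_curve w m) u.
Proof.
have -> : power_curve w m = fun z => z *: power_slope w m z.
  by apply/funext => z; exact: power_curveE.
apply: (differentiable_scale (k := id)) => //.
exact: differentiable_power_slope.
Qed.

Lemma power_curve0 w m : power_curve w m 0 = 0.
Proof. by rewrite power_curveE scale0r. Qed.

Lemma diff_power_curve w m :
  'd (power_curve w m) (0 : R[i]^o) (1 : R[i]^o) = m%:R *: w 0%N.
Proof.
rewrite -deriveE; last exact: differentiable_power_curve.
have <- : power_slope w m 0 = m%:R *: w 0%N.
  case: m => [|m]; first by rewrite /power_slope big_ord0 scale0r.
  rewrite /power_slope big_ord_recl big1 => [|k _].
    by rewrite bin1 expr0 mulr1 addr0.
  by rewrite expr0n mulr0 scale0r.
apply: derive_val; apply: eps_is_derive => e e0.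
have /differentiable_continuous/cvgr_dist_le/(_ e e0) :=
  differentiable_power_slope w m 0.
move=> /nbhs_normP[d /= d0 Hd]; exists d => // u ud.
rewrite add0r power_curve0 subr0 power_curveE -scalerBr normrZ mulrC.
rewrite ler_wpM2r// distrC; apply: Hd.
by rewrite /= sub0r normrN.
Qed.

Lemma differentiable_shifted_power_curve z w m u :
  differentiable (fun u => z + power_curve w m u) u.
Proof.
apply: (@differentiableD _ _ _ (cst z)); first exact: differentiable_cst.
exact: differentiable_power_curve.
Qed.

Lemma diff_shifted_power_curve z w m :
  'd (fun u => z + power_curve w m u) (0 : R[i]^o) (1 : R[i]^o) = m%:R *: w 0%N.
Proof.
have := @diffD _ _ _ (cst z) (power_curve w m) 0 (differentiable_cst _ _)
  (differentiable_power_curve w m 0).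
move=> /(congr1 (fun f => f 1)) /= ->.
rewrite -[RHS]add0r; congr (_ + _); last exact: diff_power_curve.
by rewrite diff_cst.
Qed.

End PowerCurve.

(** * The domain of a linear fractional transformation *)

Section Resolvent.
Context {R : realType} {H : completeNormedModType R[i]} {K : normedModType R[i]}.
Context (C : bop K H) (D : bop H H).
Implicit Types (Z W : bop H K).

Definition regular Z := binvertible (C ∘ Z + D).

Definition resolvent Z : bop K H := binv (C ∘ Z + D) ∘ C.

Lemma pencil_shift Z W : regular Z ->
  C ∘ (Z + W) + D = (C ∘ Z + D) ∘ (bid + resolvent Z ∘ W).
Proof.
move=> /binvP[ZV _]; rewrite [RHS]bcompDr bcomp1r !bcompA ZV bcomp1l.
by rewrite bcompDr addrAC.
Qed.

(** The resolvent at [Z + W] is [(1 + X_Z W)^-1 X_Z], by inverting the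
    factorization of the pencil. *)
Lemma resolvent_shift Z W : regular Z -> binvertible (bid + resolvent Z ∘ W) ->
  regular (Z + W) /\ (bid + resolvent Z ∘ W) ∘ resolvent (Z + W) = resolvent Z.
Proof.
move=> Zreg XWinv; have ZWreg : regular (Z + W).
  by rewrite /regular pencil_shift//; exact: binvertible_bcomp.
split => //; have [_ ZV] := binvP Zreg; have [ZWV _] := binvP ZWreg.
have -> : bid + resolvent Z ∘ W = binv (C ∘ Z + D) ∘ (C ∘ (Z + W) + D).
  by rewrite pencil_shift// bcompA ZV bcomp1l.
rewrite /resolvent bcompA -[_ ∘ binv (C ∘ (Z + W) + D)]bcompA ZWV.
by rewrite bcomp1r.
Qed.

Lemma resolvent_near Z W : regular Z -> rnorm (resolvent Z) * rnorm W <= 1 / 2 ->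
  [/\ rnorm (resolvent Z ∘ W) <= 1 / 2, regular (Z + W),
    (bid + resolvent Z ∘ W) ∘ resolvent (Z + W) = resolvent Z &
    rnorm (resolvent (Z + W)) <= 2 * rnorm (resolvent Z)].
Proof.
move=> Zreg XW; have XW2 := le_trans (rnorm_bcomp (resolvent Z) W) XW.
have [ZWreg E] := resolvent_shift Zreg (neumann_inverse XW2).
split => //; move: E; rewrite bcompDl bcomp1l.
set X := resolvent Z in XW XW2 *; set Y := resolvent (Z + W) => E.
have YE : Y = X - X ∘ W ∘ Y by rewrite -[X in X - _]E addrK.
have := rnormDB X (X ∘ W ∘ Y); rewrite -YE.
have := rnorm_bcomp (X ∘ W) Y; have := rnorm_ge0 Y.
by have := rnorm_ge0 (X ∘ W); nra.
Qed.

(** Both directions are instances of the Neumann argument, applied once at [Z] and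
    once at [Z + W]; the bound [1 / 4] leaves room for the resolvent to double
    from [Z] to [Z + W]. *)
Lemma triple_closed_resolvent (A : csubspace (bop H K)) Z W : csub_set A W ->
  regular Z -> rnorm (resolvent Z) * rnorm W <= 1 / 4 ->
  triple_closed A (resolvent (Z + W)) <-> triple_closed A (resolvent Z).
Proof.
move=> AW Zreg XW.
have [XW2 ZWreg E Y2] := resolvent_near Zreg (W := W) ltac:(lra).
split=> [YA|XA]; last exact: triple_closed_neumann E.
have YW : rnorm (resolvent (Z + W)) * rnorm (- W) <= 1 / 2.
  by rewrite rnormN; have := rnorm_ge0 W; nra.
have [YW2 _ E' _] := resolvent_near ZWreg YW.
rewrite addrK in E'; apply: triple_closed_neumann E' => //.
by rewrite -scaleN1r; exact: csub_setZ.
Qed.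

End Resolvent.

Section Domain.
Context {R : realType} {H K : hilbertType R}.
Context (A : csubspace (bop H K)) (C : bop K H) (D : bop H H) (Z0 : A).
Context (Z0reg : regular C D (csub_val Z0)).
Context (X0A : triple_closed A (resolvent C D (csub_val Z0))).
Implicit Types (Z W : A).

Local Notation dom := (lft_domain C D Z0).
Local Notation X_ Z := (resolvent C D (csub_val Z)).

(** Chosen so that [|X_ Z| |W| <= 1 / 4] for [|W|] below it, as comparing the
    resolvents in both directions requires. *)
Definition safe_radius Z : R := (4 * (rnorm (X_ Z) + 1))^-1.

Lemma safe_radius_gt0 Z : 0 < safe_radius Z.
Proof. by rewrite invr_gt0 mulr_gt0// ltr_wpDl// rnorm_ge0. Qed.

Lemma safe_radiusP Z W : rnorm W < safe_radius Z ->
  rnorm (X_ Z) * rnorm (csub_val W) <= 1 / 4.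
Proof.
rewrite -[rnorm (csub_val W)]/(rnorm W) /safe_radius => W4.
have X1 : 0 < rnorm (X_ Z) + 1 by rewrite ltr_wpDl// rnorm_ge0.
move: W4; rewrite invfM -ltr_pdivrMr ?invr_gt0// invrK.
by have := rnorm_ge0 W; nra.
Qed.

Lemma dom_regular Z : dom Z -> regular C D (csub_val Z).
Proof. exact: connected_component_sub. Qed.

Lemma dom_center : dom Z0.
Proof. exact: connected_component_refl. Qed.

Lemma dom_ball Z Z' : dom Z -> rnorm (Z' - Z) < safe_radius Z -> dom Z'.
Proof.
move=> ZD; move: Z' => Z' Z'Z.
apply: connected_component_trans (ZD) _.
apply: connected_component_ball Z'Z => [|Y YZ]; first exact: safe_radius_gt0.
have := safe_radiusP YZ => X4.
have [_ + _ _] := resolvent_near (dom_regular ZD) (W := csub_val (Y - Z)) ltac:(lra).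
by rewrite -[csub_val (Y - Z)]/(csub_val Y - csub_val Z) addrC subrK.
Qed.

(** The hypothesis on [X_ Z0] propagates along the component, since by
    [triple_closed_resolvent] it is neither gained nor lost in small steps. *)
Lemma dom_triple_closed Z : dom Z -> triple_closed A (X_ Z).
Proof.
move: Z; apply: (connected_locally_invariant (x := Z0)) => //.
- exact: component_connected.
- exact: dom_center.
move=> Z ZD; apply/rnorm_nbhs; exists (safe_radius Z) => [|Y YZ _].
  exact: safe_radius_gt0.
have := triple_closed_resolvent (csubP (Y - Z)) (dom_regular ZD) (safe_radiusP YZ).
by rewrite -[csub_val (Y - Z)]/(csub_val Y - csub_val Z) addrC subrK.
Qed.

Section BoundedHolomorphic.
Context {X : normedModType R[i]}.
Context (h : A -> X) (M : R).
Context (hdiff : forall Z, dom Z -> differentiable h Z).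
Context (hM : forall Z, dom Z -> rnorm (h Z) <= M).

(** The heart of the proof.  Put [T = X_ Z W].  The polynomial curve
    [u |-> Z + W ((1 + u T)^m - 1) / T], whose coefficients are Jordan powers of
    [W], stays in the domain for [|u| <= r], where [r] depends on [T] but not on
    [m]: the pencil at its points is the pencil at [Z] times [(1 + u T)^m].  Its
    velocity at 0 is [m W], so the Cauchy estimate gives
    [r * m * |dh(Z) W| <= 2 * M] for all [m]. *)
Lemma bounded_diff0 Z W : dom Z -> 'd h Z W = 0.
Proof.
move=> ZD; have XA := dom_triple_closed ZD.
set T := X_ Z ∘ csub_val W.
have T1 : 0 < rnorm T + 1 by rewrite ltr_wpDl// rnorm_ge0.
pose r := (2 * (rnorm T + 1))^-1; have r0 : 0 < r by rewrite invr_gt0 mulr_gt0.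
have rT (u : R[i]) : rnorm u <= r -> rnorm (u *: T) <= 1 / 2.
  have -> : r = 1 / 2 / (rnorm T + 1) by rewrite /r invfM div1r.
  by rewrite rnormZ ler_pdivlMr//; have := rnorm_ge0 u; nra.
have wP k : triple_pow (X_ Z) (csub_val W) k \in csub_pred A.
  by apply/asboolP; apply: triple_pow_csub => //; exact: csubP.
pose w k : A := CSub (wP k).
have valE m u : csub_val (power_curve w m u) =
    \sum_(k < m) ('C(m, k.+1)%:R * u ^+ k.+1) *: triple_pow (X_ Z) (csub_val W) k.
  rewrite /power_curve; elim/big_rec2: _ => // k x y _ <-.
  by [].
pose path m (u : R[i]^o) : A := Z + power_curve w m u.
have path_diff m u : differentiable (path m) u.
  exact: differentiable_shifted_power_curve.
have path0 m : path m 0 = Z by rewrite /path power_curve0 addr0.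
have path_dom m u : rnorm u <= r -> dom (path m u).
  move=> ur; apply: connected_component_trans (ZD) _.
  rewrite -[X in connected_component _ X](path0 m).
  apply: connected_component_path => t t01; split; last first.
    exact: differentiable_continuous.
  have tur : rnorm (t%:C *: u) <= r.
    move/andP: t01 => [t0 t1]; rewrite rnormM rnormC ger0_norm//.
    by rewrite (le_trans _ ur)// ler_piMl// rnorm_ge0.
  have := resolvent_shift (W := csub_val (power_curve w m (t%:C *: u)))
    (dom_regular ZD); move=> /(_ _)[|//].
  rewrite valE triple_pow_binomial.
  (* A product of [m] factors invertible by the Neumann series. *)
  elim: (m) => [|n IH]; first by exists bid; split; exact: bcomp1l.
  by apply: binvertible_bcomp IH; exact/neumann_inverse/rT.
have bound m : r * (m%:R * rnorm ('d h Z W)) <= 2 * M.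
  have := cauchy_estimate (f := h \o path m) r0.
  rewrite diff_comp//=; last first.
    by rewrite path0; exact: hdiff.
  rewrite path0 (_ : 'd (path m) _ _ = m%:R *: W).
    rewrite linearZ /= rnormZ rnorm_nat; apply => u ur.
      by apply: differentiable_comp => //; apply: hdiff; exact: path_dom.
    by apply: hM; exact: path_dom.
  rewrite diff_shifted_power_curve; congr (_ *: _); exact: val_inj.
apply/eqP; rewrite -rnorm_eq0; apply: contrapT => /negP d0.
have dpos : 0 < r * rnorm ('d h Z W) by rewrite mulr_gt0// lt_neqAle eq_sym d0 rnorm_ge0.
have M0 : 0 <= 2 * M by have := bound 0%N; rewrite mul0r mulr0.
have := bound (Num.Def.archi_bound (2 * M / (r * rnorm ('d h Z W)))).
rewrite mulrCA leNgt -ltr_pdivrMr// archi_boundP// divr_ge0// ltW//.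
Qed.

(** The derivative vanishes throughout the domain, hence [h] is locally constant. *)
Lemma bounded_constant Z : dom Z -> h Z = h Z0.
Proof.
move: Z; apply: (connected_locally_invariant (x := Z0)) => //.
- exact: component_connected.
- exact: dom_center.
move=> Z ZD; apply/rnorm_nbhs; exists (safe_radius Z) => [|Y YZ _].
  exact: safe_radius_gt0.
suff -> : h Y = h Z by [].
apply: zero_diff_constant YZ => V VZ; have VD := dom_ball ZD VZ.
by split => [|W]; [exact: hdiff|exact: bounded_diff0].
Qed.

End BoundedHolomorphic.
End Domain.

(** * Bounded holomorphic functions are constant *)

Lemma bounded_rnorm (R : realType) (T : Type) (X : normedModType R[i])
    (S : set T) (f : T -> X) :
  [bounded f z | z in S] -> exists M : R, forall z, S z -> rnorm (f z) <= M.
Proof.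
move=> [N [Nreal HN]]; exists (complex.Re N + 1) => z Sz.
rewrite rnorm_le; apply: HN => //=.
by rewrite rmorphD /= RRe_real// ltrDl.
Qed.

Lemma nontrivial_open_not_singleton (R : realType) (V : normedModType R[i])
    (S : set V) (x : V) : (exists v : V, v != 0) -> nbhs x S ->
  exists2 y, S y & y != x.
Proof.
move=> [v v0] /rnorm_nbhs[d d0 Hd].
have nv : 0 < rnorm v by rewrite lt_neqAle rnorm_ge0 eq_sym rnorm_eq0 v0.
pose c := (d / 2 / rnorm v)%:C.
have c0 : 0 < d / 2 / rnorm v by rewrite !divr_gt0.
exists (x + c *: v).
  apply: Hd; rewrite addrC addKr rnormZ rnormC gtr0_norm// divfK ?gt_eqF//.
  by rewrite ltr_pdivrMr// ltr_pMr// ltr1n.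
rewrite -subr_eq0 addrC addKr scaler_eq0 negb_or v0 andbT.
by rewrite -rnorm_eq0 rnormC normr_eq0 gt_eqF.
Qed.

Theorem theorem2 (R : realType) (H K : hilbertType R)
    (A : csubspace (bop H K)) (C : bop K H) (D : bop H H) (Z0 : A)
    (hZ0 : binvertible (bcomp C (csub_val Z0) + D))
    (X0 : bop K H) (hX0 : X0 = bcomp (binv (bcomp C (csub_val Z0) + D)) C)
    (hA : forall Z : bop H K,
       csub_set A Z -> csub_set A (bcomp (bcomp Z X0) Z)) :
  (forall (X : completeNormedModType R[i]) (h : A -> X),
     holomorphic_on (lft_domain C D Z0) h ->
     [bounded h Z | Z in lft_domain C D Z0] ->
     exists c : X, forall Z : A, lft_domain C D Z0 Z -> h Z = c) /\
  (forall (X : completeNormedModType R[i]) (B : set X),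
     (exists Z : A, Z != 0) \/ (exists x : X, x != 0) ->
     is_domain B -> bounded_set B ->
     ~ holo_equiv (lft_domain C D Z0) B).
Proof.
have X0A : triple_closed A (resolvent C D (csub_val Z0)).
  by move=> V AV; rewrite /resolvent -hX0; exact: hA.
have liouville (X : completeNormedModType R[i]) (h : A -> X) :
    holomorphic_on (lft_domain C D Z0) h ->
    [bounded h Z | Z in lft_domain C D Z0] ->
    exists c : X, forall Z : A, lft_domain C D Z0 Z -> h Z = c.
  move=> hdiff /bounded_rnorm[M hM].
  by exists (h Z0); exact: (bounded_constant hZ0 X0A hdiff hM).
split=> [|X B nontriv [_ Bopen _] /bounded_rnorm[M BM]]; first exact: liouville.
move=> [f [fholo [fB finj fsurj] _]].
have [|c fc] := liouville X f fholo.
  exists M%:C; split; first by apply/complex_realP; exists M.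
  move=> N MN Z ZD; apply: le_trans (ltW MN); rewrite -rnorm_le.
  by apply: BM; exact: fB.
have ZD0 := dom_center hZ0.
(* A constant bijection forces both sides to be single points, which no open
   set of a nonzero space is. *)
case: nontriv => [Anz|Xnz].
  have : nbhs Z0 (lft_domain C D Z0).
    apply/rnorm_nbhs; exists (safe_radius C D Z0) => [|Y]; first exact: safe_radius_gt0.
    exact: dom_ball.
  move=> /(nontrivial_open_not_singleton Anz)[Z ZD /eqP]; apply.
  by apply: finj; rewrite ?inE// !fc.
have Bfc : B c by rewrite -(fc Z0 ZD0); exact: fB.
have [y By /eqP] := nontrivial_open_not_singleton Xnz (open_nbhs_nbhs (conj Bopen Bfc)).
by apply; have [Z ZD <-] := fsurj y By; exact: fc.
Qed.
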